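(* For any $\gamma>1$ and $p\in\mathcal{P}_K$, the quadratic risk of the sequentially interactive estimator $\widetilde F_\gamma$ is bounded by $$\mathbb{E}\left[(\widetilde F_\gamma-F_\gamma)^2\right]\lesssim_\gamma\frac{1}{(\alpha^2n)^{(\gamma-1)\wedge1}}+\mathbf{1}_{\{\gamma\ge3\}}\frac{\|p^{\ge\tau}\|_{\gamma-2}^{2(\gamma-2)}}{(\alpha^2n)^2}+\mathbf{1}_{\{\gamma\ge2\}}\frac{\|p^{\ge\tau}\|_{2\gamma-2}^{2\gamma-2}}{\alpha^2n},$$ and thus is uniformly bounded over all $p\in\mathcal{P}_K$ by $$\sup_{p\in\mathcal{P}_K}\mathbb{E}\left[(\widetilde F_\gamma-F_\gamma)^2\right]\lesssim_\gamma\frac{1}{(\alpha^2n)^{\gamma-1}}+\frac{1}{\alpha^2n}.$$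
   Context: $K,n$ are positive integers, $[K]=\{1,\dots,K\}$, and the privacy level $\alpha\in(0,1)$ satisfies $\alpha^2 n\ge 1$. $\mathcal{P}_K=\{p\in[0,1]^K:\sum_{k=1}^K p_k=1\}$, and $F_\gamma=F_\gamma(p)=\sum_{k=1}^K p_k^\gamma$. The sample size is $2n$: the sensitive data $x^{(1)}=(x^{(1)}_1,\dots,x^{(1)}_n)$ and $x^{(2)}=(x^{(2)}_1,\dots,x^{(2)}_n)$ are all i.i.d. with $\mathbb{P}(x=k)=p_k$, $k\in[K]$. First half (non-interactive Laplace mechanism): $z^{(1)}_{ik}=\mathbf{1}_{\{x^{(1)}_i=k\}}+\frac{\sigma}{\alpha}w_{ik}$, $i=1,\dots,n$, $k\in[K]$, where $\sigma=2$ and the $w_{ik}$ are i.i.d. with density $\frac12e^{-|x|}$, independent of the data. Put $\hat z^{(1)}_k=\frac1n\sum_{i=1}^nz^{(1)}_{ik}$, $T_{[0,2]}[y]=(y\vee0)\wedge2$, and $\hat F^{(1)}_{\gamma-1}(k)=(T_{[0,2]}[\hat z^{(1)}_k])^{\gamma-1}$. Second half (sequentially interactive mechanism): with $z_\alpha=2^{\gamma-1}\frac{e^\alpha+1}{e^\alpha-1}$, each individual $i=1,\dots,n$ releases, independently of the others conditionally on $z^{(1)}$ and $x^{(2)}$, $$z^{(2)}_i=\pm z_\alpha\quad\text{with probability}\quad\frac12\left(1\pm\frac{1}{z_\alpha}\hat F^{(1)}_{\gamma-1}(x^{(2)}_i)\right).$$ The estimator is $\widetilde F_\gamma=\frac1n\sum_{i=1}^nz^{(2)}_i$.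 $\tau=c/\sqrt{\alpha^2n}$ with $c\ge1$ a fixed numerical constant; $p^{\ge\tau}$ is the vector with coordinates $p_k\mathbf{1}(p_k\ge\tau)$, and for real $r$, $\|p^{\ge\tau}\|_r^r=\sum_{k:\,p_k\ge\tau}p_k^r$ (so $\|p^{\ge\tau}\|_{\gamma-2}^{2(\gamma-2)}=(\sum_{k:\,p_k\ge\tau}p_k^{\gamma-2})^2$). $x\wedge y=\min\{x,y\}$, $x\vee y=\max\{x,y\}$; $x\lesssim_\gamma y$ means $x\le C_\gamma y$ for some constant $C_\gamma$ depending only on $\gamma$. *)

(* Defs.v *)
From HB Require Import structures.
From mathcomp Require Import all_boot all_order all_algebra.
From mathcomp Require Import all_classical all_reals all_analysis.

Set Implicit Arguments.
Unset Strict Implicit.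
Unset Printing Implicit Defensive.

Import Order.TTheory GRing.Theory Num.Theory.
Import numFieldNormedType.Exports.

Local Open Scope classical_set_scope.
Local Open Scope ring_scope.

(* The alphabet [K] = {1, ..., K} is represented by the type 'I_K. *)

Definition simplex (R : realType) (K : nat) : set ('I_K -> R) :=
  [set p | (forall k, 0 <= p k <= 1) /\ \sum_(k < K) p k = 1].

Definition power_sum (R : realType) (K : nat) (gamma : R) (p : 'I_K -> R) : R :=
  \sum_(k < K) p k `^ gamma.

(* ||p^{>= tau}||_r^r; only used with tau > 0, so that no zero entry is raised
   to a power. *)
Definition trunc_power_sum (R : realType) (K : nat) (tau r : R)
    (p : 'I_K -> R) : R :=
  \sum_(k < K | tau <= p k) p k `^ r.

Definition laplace_density (R : realType) (x : R) : R := expR (- `|x|) / 2.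

(* The sigma-algebra generated by a map into a finite alphabet, all of whose
   subsets are measurable. *)
Definition sigma_discrete (T : Type) (K : nat) (x : T -> 'I_K) : set (set T) :=
  preimage_set_system [set: T] x [set: set 'I_K].

Definition sigma_real (R : realType) (T : Type) (y : T -> R) : set (set T) :=
  preimage_set_system [set: T] y measurable.

Definition mutually_independent (R : realType) (d : measure_display)
    (T : measurableType d) (P : probability T R) (I : finType)
    (F : I -> set (set T)) : Prop :=
  forall (J : {set I}) (A : I -> set T), (forall i, i \in J -> F i (A i)) ->
  P (\bigcap_(i in [set` J]) A i) = (\prod_(i in J) P (A i))%E.

(* f is a version of the conditional probability of the event A given the
   sub-sigma-algebra G. *)
Definition is_cond_prob (R : realType) (d : measure_display)
    (T : measurableType d) (P : probability T R) (G : set (set T)) (A : set T)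
    (f : T -> R) : Prop :=
  (forall B : set R, measurable B -> G (f @^-1` B)) /\
  (forall B, G B -> (\int[P]_(t in B) (f t)%:E = P (A `&` B))%E).

Definition laplace_release (R : realType) (T : Type) (n K : nat) (alpha : R)
    (x1 : 'I_n -> T -> 'I_K) (w : 'I_n -> 'I_K -> T -> R)
    (i : 'I_n) (k : 'I_K) (t : T) : R :=
  (x1 i t == k)%:R + 2 / alpha * w i k t.

Definition laplace_mean (R : realType) (T : Type) (n K : nat) (alpha : R)
    (x1 : 'I_n -> T -> 'I_K) (w : 'I_n -> 'I_K -> T -> R)
    (k : 'I_K) (t : T) : R :=
  n%:R^-1 * \sum_(i < n) laplace_release alpha x1 w i k t.

Definition clip02 (R : realType) (y : R) : R := Num.min (Num.max y 0) 2.

Definition first_estimate (R : realType) (T : Type) (n K : nat)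
    (alpha gamma : R) (x1 : 'I_n -> T -> 'I_K) (w : 'I_n -> 'I_K -> T -> R)
    (k : 'I_K) (t : T) : R :=
  clip02 (laplace_mean alpha x1 w k t) `^ (gamma - 1).

Definition z_level (R : realType) (alpha gamma : R) : R :=
  2 `^ (gamma - 1) * ((expR alpha + 1) / (expR alpha - 1)).

Definition sigma_z1_x2 (R : realType) (T : Type) (n K : nat) (alpha : R)
    (x1 x2 : 'I_n -> T -> 'I_K) (w : 'I_n -> 'I_K -> T -> R) : set (set T) :=
  <<s (\bigcup_i \bigcup_k sigma_real (laplace_release alpha x1 w i k)) `|`
      (\bigcup_i sigma_discrete (x2 i)) >>.

Definition sigma_inputs (R : realType) (T : Type) (n K : nat)
    (x1 x2 : 'I_n -> T -> 'I_K) (w : 'I_n -> 'I_K -> T -> R)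
    (a : 'I_n + 'I_n + 'I_n * 'I_K) : set (set T) :=
  match a with
  | inl (inl i) => sigma_discrete (x1 i)
  | inl (inr i) => sigma_discrete (x2 i)
  | inr (i, k) => sigma_real (w i k)
  end.

(* Under P, the data x1, x2 have law p, w is the Laplace noise of the first
   half and z2 the release of the second half.  In si_second_half, the sign s i
   is encoded as (-1) ^+ s i, i.e., true stands for minus; the singletons J
   give the conditional law of each z2 i, the other J their conditional
   independence given z1 and x2. *)
Record si_experiment (R : realType) (d : measure_display)
    (T : measurableType d) (P : probability T R) (n K : nat) (alpha gamma : R)
    (p : 'I_K -> R) (x1 x2 : 'I_n -> T -> 'I_K)
    (w : 'I_n -> 'I_K -> {mfun T >-> R}) (z2 : 'I_n -> {mfun T >-> R}) : Prop :=
  SIExperiment {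
    si_measurable_x1 : forall i k, measurable (x1 i @^-1` [set k]) ;
    si_measurable_x2 : forall i k, measurable (x2 i @^-1` [set k]) ;
    si_law_x1 : forall i k, P (x1 i @^-1` [set k]) = (p k)%:E ;
    si_law_x2 : forall i k, P (x2 i @^-1` [set k]) = (p k)%:E ;
    si_law_w : forall i k (B : set R), measurable B ->
      P (w i k @^-1` B) =
        (\int[lebesgue_measure]_(x in B) (laplace_density x)%:E)%E ;
    si_independent :
      mutually_independent P (sigma_inputs x1 x2 (fun i k => w i k)) ;
    si_second_half : forall (J : {set 'I_n}) (s : 'I_n -> bool),
      is_cond_prob P (sigma_z1_x2 alpha x1 x2 (fun i k => w i k))
        [set t | forall i, i \in J -> z2 i t = (-1) ^+ s i * z_level alpha gamma]
        (fun t => \prod_(i in J)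
           ((1 + (-1) ^+ s i / z_level alpha gamma *
                 first_estimate alpha gamma x1 (fun i k => w i k) (x2 i t) t)
            / 2))
  }.

Definition si_estimator (R : realType) (T : Type) (n : nat)
    (z2 : 'I_n -> T -> R) (t : T) : R :=
  n%:R^-1 * \sum_(i < n) z2 i t.

Definition quadratic_risk (R : realType) (d : measure_display)
    (T : measurableType d) (P : probability T R) (n K : nat) (gamma : R)
    (p : 'I_K -> R) (z2 : 'I_n -> T -> R) : \bar R :=
  'E_P[(fun t => (si_estimator z2 t - power_sum gamma p) ^+ 2)%R]%E.

(* Main.v *)
Require Import Defs.
From HB Require Import structures.
From mathcomp Require Import all_boot all_order all_algebra.
From mathcomp Require Import all_classical all_reals all_analysis.
From mathcomp Require Import measurable_realfun ring lra.

(* Write s = gamma - 1, q_k = p_k^s, g_k for the first-half estimate of q_k and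
   m = alpha^2 n >= 1.  Since every other term is nonnegative, it suffices to
   bound the risk by C / m^(min(s, 1)).  The error splits as
     1/n sum_i (z2_i - g_{x2_i}) + 1/n sum_i (g_{x2_i} - q_{x2_i})
       + (1/n sum_i q_{x2_i} - F).
   The first and last terms are means of n uncorrelated centered variables,
   bounded by O(1/alpha) and 1 respectively, so their second moments are O(1/m).
   In the middle term, Jensen's inequality reduces to the squares of g_k - q_k,
   which the modulus of continuity of y |-> y^s on [0, 2] bounds by
   C m^(-min(s, 1)) (1 + m (zhat_k - p_k)^2), and zhat_k - p_k, independent of
   x2_i, has variance O(1/m). *)

Set Implicit Arguments.
Unset Strict Implicit.
Unset Printing Implicit Defensive.

Import Order.TTheory GRing.Theory Num.Theory.
Import numFieldNormedType.Exports.

Local Open Scope classical_set_scope.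
Local Open Scope ring_scope.

(** * Power functions on [0, 2] *)

Section powR_modulus.
Variable R : realType.
Implicit Types s a b m : R.

(** All releases use the same first-half data, so the summands of the first term are not
    independent; their cross moments vanish only by conditioning on [z1] and [x2]. The summands of
    the middle term are moreover biased, so no cancellation between individuals is exploited there,
    and this term sets the rate: the other two are O(1/m), and 1/m <= m^(-min(s, 1)). The obstacle
    in the middle term is the random index x2_i. It is removed by splitting over the events x2_i =
    k. Each is independent of the first half, hence contributes p_k times a bound free of k, and the
    p_k sum to 1; this is why no power of K appears. It is also why the moment lemmas below carry an
    indicator weight [\1_A] and a factor [P A]. Independence, the Laplace law and the conditional
    law of the releases are all given on events. The passage from events to integrals of functions
    is the same each time and goes through [integral_transfer]. *)

Lemma powR_le1 s a : 0 <= s -> 0 <= a -> a <= 1 -> a `^ s <= 1.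
Proof.
move=> s0 a0 a1; have := @ge0_ler_powR R s s0 a 1.
by rewrite !nnegrE powR1; exact.
Qed.

(** Dividing by [a] and putting r = b / a reduces this to 1 <= r^s + (1 - r)^s, which follows from t
    <= t^s on [0, 1] applied to r and to 1 - r. *)
Lemma powR_sub_le_low s a b : 0 < s -> s <= 1 -> 0 <= b -> b <= a ->
  a `^ s - b `^ s <= (a - b) `^ s.
Proof.
move=> s0 s1 b0 ba.
have [b00|bn0] := eqVneq b 0.
  by rewrite b00 powR0 ?gt_eqF// !subr0.
have a0 : 0 < a by rewrite (lt_le_trans _ ba)// lt_neqAle eq_sym bn0.
have key r : 0 <= r -> r <= 1 -> r <= r `^ s.
  move=> r0 r1; have [->|rn0] := eqVneq r 0; first exact: powR_ge0.
  by rewrite ger1_powR// r1 lt_neqAle eq_sym rn0 r0.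
have [r [r0 r1 bar]] : exists r, [/\ 0 <= r, r <= 1 & b = a * r].
  exists (b / a); split; first by rewrite divr_ge0// ltW.
    by rewrite ler_pdivrMr// mul1r.
  by rewrite mulrC divfK// gt_eqF.
have -> : a - b = a * (1 - r) by rewrite bar; ring.
rewrite bar !powRM ?subr_ge0 ?(ltW a0)//.
rewrite -{1}(mulr1 (a `^ s)) -mulrBr ler_wpM2l ?powR_ge0//.
have h1 := key _ r0 r1.
have h2 : 1 - r <= (1 - r) `^ s by apply: key; lra.
lra.
Qed.

(** Bernoulli's inequality replaces differentiation: rounding s up to an integer N gives 1 - r^s <=
    1 - r^N <= N (1 - r) for r = b / a, while a^s = a a^(s-1) <= a 2^(s-1). Hence N in place of the
    sharp factor s. *)
Lemma powR_sub_le_high s a b : 1 <= s -> 0 <= b -> b <= a -> a <= 2 ->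
  a `^ s - b `^ s <= (Num.truncn s).+1%:R * 2 `^ (s - 1) * (a - b).
Proof.
move=> s1 b0 ba a2; set N := (Num.truncn s).+1.
have s0 : 0 < s by exact: lt_le_trans s1.
have [b00|bn0] := eqVneq a 0.
  have -> : b = a by apply/eqP; rewrite eq_le ba b00 b0.
  by rewrite !subrr mulr0.
have a0 : 0 < a by rewrite lt_neqAle eq_sym bn0 (le_trans b0).
have [r [r0 r1 bar]] : exists r, [/\ 0 <= r, r <= 1 & b = a * r].
  exists (b / a); split; first by rewrite divr_ge0// ltW.
    by rewrite ler_pdivrMr// mul1r.
  by rewrite mulrC divfK// gt_eqF.
have sN : s <= N%:R by exact/ltW/truncnS_gt.
have rN : r ^+ N <= r `^ s.
  have [->|rn0] := eqVneq r 0; first by rewrite expr0n powR_ge0.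
  have rpos : 0 < r by rewrite lt_neqAle eq_sym rn0.
  (* r^N is (r^s)^(N/s), with base at most 1 and exponent at least 1. *)
  rewrite -powR_mulrn// (_ : N%:R = s * (N%:R / s)); last first.
    by rewrite mulrC divfK// gt_eqF.
  rewrite powRrM ge1r_powR//; last by rewrite ler_pdivlMr// mul1r.
  by rewrite powR_gt0//= powR_le1// ltW.
have bern k : 1 - r ^+ k <= k%:R * (1 - r).
  elim: k => [|k IH]; first by rewrite expr0 subrr mul0r.
  have rk : r ^+ k <= 1 by rewrite exprn_ile1.
  have rk0 : 0 <= r ^+ k by rewrite exprn_ge0.
  rewrite exprSr -natr1; nra.
have -> : a - b = a * (1 - r) by rewrite bar; ring.
rewrite {1}bar powRM ?(ltW a0)//.
have -> : a `^ s = a * a `^ (s - 1).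
  have e : a `^ (1 + (s - 1)) = a `^ 1 * a `^ (s - 1).
    by apply: powRD; rewrite bn0 implybT.
  by move: e; rewrite addrC subrK => ->; rewrite powRr1// ltW.
have a2s : a `^ (s - 1) <= 2 `^ (s - 1).
  by rewrite ge0_ler_powR ?nnegrE ?subr_ge0// ltW.
have -> : a * a `^ (s-1) - a * a `^ (s-1) * r `^ s =
  a * a `^ (s - 1) * (1 - r `^ s) by ring.
have -> : N%:R * 2 `^ (s-1) * (a * (1 - r)) = a * 2 `^ (s-1) * (N%:R * (1 - r)).
  by ring.
apply: (@le_trans _ _ (a * a `^ (s-1) * (N%:R * (1 - r)))).
  have bernN := bern N.
  by apply: ler_wpM2l; [rewrite mulr_ge0 ?powR_ge0// ltW|lra].
by apply: ler_wpM2r; [rewrite mulr_ge0 ?subr_ge0|rewrite ler_wpM2l// ltW].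
Qed.

(** The bracket unifies two regimes, with d = |a - b|. If s <= 1, then d^(2s) = m^(-s) (m d^2)^s <=
    m^(-s) (1 + m d^2), which accounts for the 1 in the constant; if s >= 1, the Lipschitz bound
    gives L^2 d^2 = L^2 m^(-1) (m d^2). Once d^2 has mean O(1/m), the bracket has bounded mean and
    only the rate remains. *)
Lemma powR_sub_sqr_le s : 0 < s -> exists C : R, 0 < C /\
  forall a b m, 0 <= a <= 2 -> 0 <= b <= 2 -> 1 <= m ->
  (a `^ s - b `^ s) ^+ 2 <=
    C * ((m `^ Num.min s 1)^-1 * (1 + m * (a - b) ^+ 2)).
Proof.
move=> s0; pose L : R := (Num.truncn s).+1%:R * 2 `^ (s - 1).
have L0 : 0 <= L by rewrite mulr_ge0// powR_ge0.
exists (1 + L ^+ 2); split; first by rewrite ltr_pwDl// sqr_ge0.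
move=> a b m; wlog ba : a b / b <= a.
  move=> H; have [|/ltW] := leP b a; first exact: H.
  by move=> ab ha hb hm; rewrite -sqrrN opprB -(opprB b a) sqrrN; exact: H.
move=> /andP[a0 a2] /andP[b0 b2] m1; have m0 : 0 < m by exact: lt_le_trans m1.
have ab0 : 0 <= a `^ s - b `^ s.
  by rewrite subr_ge0 ge0_ler_powR ?nnegrE// ltW.
have [s1|/ltW s1] := leP s 1.
  rewrite (le_trans (y := ((a - b) `^ s) ^+ 2))//.
    by rewrite ler_pXn2r ?nnegrE ?powR_ge0// powR_sub_le_low.
  rewrite (le_trans (y := (m `^ s)^-1 * (1 + m * (a - b) ^+ 2)))//; last first.
    rewrite ler_peMl ?lerDl ?sqr_ge0// mulr_ge0 ?invr_ge0 ?powR_ge0//.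
    by rewrite addr_ge0// mulr_ge0 ?sqr_ge0// ltW.
  rewrite ler_pdivlMl ?powR_gt0//.
  have -> : m `^ s * (a - b) `^ s ^+ 2 = (m * (a - b) ^+ 2) `^ s.
    by rewrite powRM ?sqr_ge0 ?(ltW m0)// expr2 powRM ?subr_ge0.
  (* t^s <= 1 + t for all t >= 0 *)
  set t := m * _; have t0 : 0 <= t by rewrite mulr_ge0 ?sqr_ge0// ltW.
  have [t1|/ltW t1] := leP t 1.
    apply: (@le_trans _ _ 1); last by rewrite lerDl.
    by rewrite powR_le1// ltW.
  by apply: (@le_trans _ _ t); [exact: ler1_powR|rewrite lerDr].
rewrite powRr1 ?(ltW m0)//.
have H := powR_sub_le_high s1 b0 ba a2; rewrite -/L in H.
apply: (@le_trans _ _ ((L * (a - b)) ^+ 2)).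
  by rewrite ler_pXn2r ?nnegrE// mulr_ge0// subr_ge0.
have -> : m^-1 * (1 + m * (a - b) ^+ 2) = m^-1 + (a - b) ^+ 2.
  by field; rewrite gt_eqF.
rewrite exprMn.
have i0 : 0 <= m^-1 by rewrite invr_ge0 ltW.
have := sqr_ge0 L; have := sqr_ge0 (a - b); nra.
Qed.

End powR_modulus.

(** * Integrals determined by push-forward measures *)

Section integral_transfer.
Local Open Scope ereal_scope.
Import HBNNSimple.

Lemma ge0_integral_comp_weight d (T : measurableType d) (R : realType)
    (mu : {measure set T -> \bar R}) (f u : T -> R) (phi : R -> R)
    (mphi : measurable_fun [set: R] (EFin \o phi)) :
  measurable_fun [set: T] f -> measurable_fun [set: T] u ->
  (forall x, 0 <= u x)%R -> (forall y, 0 <= phi y)%R ->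
  let g := nnsfun_approx measurableT mphi in
  \int[mu]_x (phi (f x) * u x)%:E =
  limn (fun n => \sum_(y \in range (g n))
     y%:E * \int[mu]_(x in f @^-1` (g n @^-1` [set y])) (u x)%:E).
Proof.
move=> mf mu_ u0 phi0 g.
have mg n : measurable_fun [set: T] (fun x => g n (f x)).
  exact: measurableT_comp.
transitivity (limn (fun n => \int[mu]_x (g n (f x) * u x)%:E)).
  rewrite -monotone_convergence//.
  - apply: eq_integral => x _; apply/esym/cvg_lim => //.
    under eq_fun do rewrite EFinM.
    rewrite EFinM; apply: cvgeZr => //.
    by apply: cvg_nnsfun_approx => // y _; rewrite lee_fin.
  - by move=> n; apply/measurable_EFinP; apply: measurable_funM.
  - by move=> n x _; rewrite lee_fin mulr_ge0.
  - move=> x _ a b ab; rewrite lee_fin ler_wpM2r//.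
    exact/lefP/nd_nnsfun_approx.
congr (limn _); apply/funext => n.
have mP y : measurable (f @^-1` (g n @^-1` [set y])).
  by rewrite -[X in measurable X]setTI; apply: mf => //; apply: measurable_sfunP.
have mu_E : measurable_fun [set: T] (EFin \o u) by exact/measurable_EFinP.
transitivity (\int[mu]_x (\sum_(y \in range (g n))
    (y%:E * ((EFin \o u) \_ (f @^-1` (g n @^-1` [set y]))) x))).
  apply: eq_integral => x _; rewrite {1}(fimfunE (g n)) EFinM -fsumEFin//.
  rewrite ge0_mule_fsuml => [|y]; last exact: nnfun_muleindic_ge0.
  apply: eq_fsbigr => y _; rewrite EFinM -muleA; congr (_ * _).
  rewrite patchE indicE.
  have -> : (f x \in g n @^-1` [set y]) = (x \in f @^-1` (g n @^-1` [set y])) by [].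
  by case: (x \in _); rewrite ?mul1e ?mul0e.
have mr y : measurable_fun [set: T] ((EFin \o u) \_ (f @^-1` (g n @^-1` [set y]))).
  by apply/(measurable_restrictT _ _).1 => //; exact: measurable_funTS.
have r0 y x : 0 <= ((EFin \o u) \_ (f @^-1` (g n @^-1` [set y]))) x.
  by apply: erestrict_ge0 => z _; rewrite lee_fin.
rewrite ge0_integral_fsum//.
- apply: eq_fsbigr => y; rewrite inE => -[z _ <-].
  rewrite ge0_integralZl//.
  + by rewrite -integral_mkcond.
  + by rewrite lee_fin.
- by move=> y; apply: measurable_funeM.
- move=> y x _; have [y0|y0] := leP 0%R y.
    by apply: mule_ge0; rewrite ?lee_fin.
  by rewrite preimage_nnfun0// preimage_set0 patch_set0 mule0.
Qed.

(** Equal push-forwards give equal integrals. The weights make it serve several purposes: a density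
    for the Laplace law, an indicator for independence, a conditional probability for
    conditioning. *)
Lemma integral_transfer d1 (T1 : measurableType d1) d2 (T2 : measurableType d2)
    (R : realType) (m1 : {measure set T1 -> \bar R})
    (m2 : {measure set T2 -> \bar R}) (f1 u1 : T1 -> R) (f2 u2 : T2 -> R)
    (phi : R -> R) :
  measurable_fun [set: T1] f1 -> measurable_fun [set: T2] f2 ->
  measurable_fun [set: T1] u1 -> measurable_fun [set: T2] u2 ->
  (forall x, 0 <= u1 x)%R -> (forall x, 0 <= u2 x)%R ->
  measurable_fun [set: R] phi -> (forall y, 0 <= phi y)%R ->
  (forall C : set R, measurable C ->
     \int[m1]_(x in f1 @^-1` C) (u1 x)%:E = \int[m2]_(x in f2 @^-1` C) (u2 x)%:E) ->
  \int[m1]_x (phi (f1 x) * u1 x)%:E = \int[m2]_x (phi (f2 x) * u2 x)%:E.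
Proof.
move=> mf1 mf2 mu1 mu2 u10 u20 /measurable_EFinP mphi phi0 fu.
rewrite !(ge0_integral_comp_weight _ mphi)//; congr (limn _); apply/funext => n.
by apply: eq_fsbigr => y _; rewrite fu.
Qed.

End integral_transfer.

(** * Independence and second moments of means *)

Section independence.
Context d (T : measurableType d) (R : realType) (P : probability T R).
Local Open Scope ereal_scope.
Implicit Types (A : set T) (X Y w : T -> R).

Let mpre X (C : set R) : measurable_fun [set: T] X -> measurable C ->
  measurable (X @^-1` C).
Proof. by move=> mX mC; rewrite -[X in measurable X]setTI; exact: mX. Qed.

Let mind A : measurable A -> measurable_fun [set: T] (\1_A : T -> R).
Proof. by move=> mA; exact: measurable_indic. Qed.

Let icst A (r : R) : measurable A -> \int[P]_(x in A) r%:E = r%:E * P A.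
Proof. by move=> mA; exact: integral_cst. Qed.

Let iZ (f : T -> R) (c : R) : measurable_fun [set: T] f ->
  (forall t, 0 <= f t)%R -> (0 <= c)%R ->
  \int[P]_t (f t * c)%:E = c%:E * \int[P]_t (f t)%:E.
Proof.
move=> mf f0 c0; rewrite -ge0_integralZl//.
- by apply: eq_integral => t _; rewrite mulrC.
- exact/measurable_EFinP.
- by move=> t _; rewrite lee_fin.
Qed.

(** Two transfers. Along [X], the indicator of A and Y in D is exchanged for the constant P(A) P(Y
    in D); then, along [Y], the weight [phi (X t) * \1_A t] is exchanged for its mean. Finiteness of
    that mean makes it a real constant weight. *)
Lemma integral_indepM_ge0 A X Y (phi psi : R -> R) :
  measurable A -> measurable_fun [set: T] X -> measurable_fun [set: T] Y ->
  measurable_fun [set: R] phi -> measurable_fun [set: R] psi ->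
  (forall x, 0 <= phi x)%R -> (forall x, 0 <= psi x)%R ->
  (forall C D : set R, measurable C -> measurable D ->
    P (A `&` (X @^-1` C `&` Y @^-1` D)) =
    P A * (P (X @^-1` C) * P (Y @^-1` D))) ->
  \int[P]_t (phi (X t))%:E < +oo ->
  \int[P]_t (\1_A t * (phi (X t) * psi (Y t)))%:E =
  P A * (\int[P]_t (phi (X t))%:E * \int[P]_t (psi (Y t))%:E).
Proof.
move=> mA mX mY mphi mpsi phi0 psi0 indep finX.
have mphiX : measurable_fun [set: T] (phi \o X) by exact: measurableT_comp.
have iX0 : 0 <= \int[P]_t (phi (X t))%:E.
  by apply: integral_ge0 => t _; rewrite lee_fin.
have step D : measurable D ->
  \int[P]_(t in Y @^-1` D) (phi (X t) * \1_A t)%:E =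
  P A * P (Y @^-1` D) * \int[P]_t (phi (X t))%:E.
  move=> mD; rewrite integral_mkcond.
  transitivity (\int[P]_t (phi (X t) * \1_(A `&` Y @^-1` D) t)%:E).
    apply: eq_integral => t _; rewrite patchE indicI/=.
    by rewrite [\1_(_ @^-1` _) _]indicE; case: (t \in _); rewrite ?mulr1 ?mulr0.
  have c_fin : P A * P (Y @^-1` D) \is a fin_num.
    by rewrite fin_numM// fin_num_measure// ; exact: mpre.
  rewrite (@integral_transfer _ _ _ _ _ P P X _ X
     (cst (fine (P A * P (Y @^-1` D)))))//; last 3 first.
  - exact/mind/measurableI/mpre.
  - by move=> t; rewrite /= fine_ge0// mule_ge0.
  - move=> C mC; rewrite integral_indic//; first last.
    + exact/measurableI/mpre.
    + exact: mpre.
    rewrite /= icst ?fineK//; last exact: mpre.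
    rewrite -setIA [Y @^-1` _ `&` _]setIC indep//.
    by rewrite -muleA [P (Y @^-1` D) * _]muleC.
  rewrite /= (@iZ (phi \o X)) ?fineK//; first by move=> t; exact: phi0.
  by rewrite fine_ge0// mule_ge0.
have c_fin : P A * \int[P]_t (phi (X t))%:E \is a fin_num.
  by rewrite fin_numM ?fin_num_measure// ge0_fin_numE.
transitivity (\int[P]_t (psi (Y t) * (phi (X t) * \1_A t))%:E).
  by apply: eq_integral => t _; congr EFin; ring.
rewrite (@integral_transfer _ _ _ _ _ P P Y _ Y
     (cst (fine (P A * \int[P]_t (phi (X t))%:E))))//; last 4 first.
- exact/measurable_funM/mind.
- by move=> t; rewrite mulr_ge0// indicE.
- by move=> t; rewrite /= fine_ge0// mule_ge0.
- move=> D mD; rewrite step// /= icst ?fineK//; last exact: mpre.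
  by rewrite -!muleA [P (Y @^-1` D) * _]muleC.
rewrite /= (@iZ (psi \o Y)) ?fineK ?muleA//.
- exact: measurableT_comp.
- by move=> t; exact: psi0.
- by rewrite fine_ge0// mule_ge0.
Qed.

(** The nonnegative case applies to the four products of positive and negative parts. Centering of
    [X] says that its two parts have the same mean, so the four terms cancel in pairs. *)
Lemma integral_indepM_eq0 A X Y : measurable A ->
  P.-integrable [set: T] (EFin \o X) -> P.-integrable [set: T] (EFin \o Y) ->
  (forall C D : set R, measurable C -> measurable D ->
    P (A `&` (X @^-1` C `&` Y @^-1` D)) =
    P A * (P (X @^-1` C) * P (Y @^-1` D))) ->
  \int[P]_t (X t)%:E = 0 ->
  P.-integrable [set: T] (fun t => (\1_A t * (X t * Y t))%:E) /\
  \int[P]_t (\1_A t * (X t * Y t))%:E = 0.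
Proof.
move=> mA iX iY indep EX0.
have mX : measurable_fun [set: T] X by apply/measurable_EFinP; case/integrableP: iX.
have mY : measurable_fun [set: T] Y by apply/measurable_EFinP; case/integrableP: iY.
pose pos (x : R) := Num.max x 0%R; pose neg (x : R) := Num.max (- x)%R 0%R.
have mpos : measurable_fun [set: R] pos by exact: measurable_maxr.
have mneg : measurable_fun [set: R] neg.
  exact: measurable_maxr.
have pos0 x : (0 <= pos x)%R by rewrite le_max lexx orbT.
have neg0 x : (0 <= neg x)%R by rewrite le_max lexx orbT.
have posneg x : (x = pos x - neg x)%R.
  by rewrite /pos /neg; case: (leP x 0%R); case: (leP (- x)%R 0%R); lra.
have i_of (Z : T -> R) (phi : R -> R) : P.-integrable [set: T] (EFin \o Z) ->
    measurable_fun [set: R] phi -> (forall x, `|phi x| <= `|x|)%R ->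
    P.-integrable [set: T] (EFin \o (phi \o Z)).
  move=> iZ' mphi phile; apply: (le_integrable measurableT _ _ iZ').
    apply/measurable_EFinP/measurableT_comp => //.
    by apply/measurable_EFinP; case/integrableP : iZ'.
  by move=> t _ /=; rewrite lee_fin.
have posle x : (`|pos x| <= `|x|)%R.
  by rewrite ger0_norm// /pos; case: (leP x 0%R) => // ?; rewrite ler_norm.
have negle x : (`|neg x| <= `|x|)%R.
  rewrite ger0_norm// /neg; case: (leP (- x)%R 0%R) => // ?.
  by rewrite -normrN ler_norm.
have fin (phi : R -> R) : (forall x, 0 <= phi x)%R -> measurable_fun [set: R] phi ->
   (forall x, `|phi x| <= `|x|)%R -> \int[P]_t (phi (X t))%:E < +oo.
  by move=> phi0 mphi phile; exact: (integrable_lty measurableT (i_of X phi iX mphi phile)).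
have finY (phi : R -> R) : (forall x, 0 <= phi x)%R -> measurable_fun [set: R] phi ->
   (forall x, `|phi x| <= `|x|)%R -> \int[P]_t (phi (Y t))%:E < +oo.
  by move=> phi0 mphi phile; exact: (integrable_lty measurableT (i_of Y phi iY mphi phile)).
have finE (phi : R -> R) (Z : T -> R) : (forall x, 0 <= phi x)%R ->
    \int[P]_t (phi (Z t))%:E < +oo -> \int[P]_t (phi (Z t))%:E \is a fin_num.
  move=> phi0; rewrite ge0_fin_numE//.
  by apply: integral_ge0 => t _; rewrite lee_fin.
have posf := finE pos X pos0 (fin pos pos0 mpos posle).
have negf := finE neg X neg0 (fin neg neg0 mneg negle).
have Epn : \int[P]_t (pos (X t))%:E = \int[P]_t (neg (X t))%:E.
  have := EX0; have -> : \int[P]_t (X t)%:E =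
      \int[P]_t ((pos (X t))%:E - (neg (X t))%:E).
    by apply: eq_integral => t _; rewrite -EFinB -posneg.
  rewrite integralB_EFin//; [|exact: (i_of X pos iX)|exact: (i_of X neg iX)].
  move/eqP; rewrite sube_eq ?add0e; first by move/eqP.
    exact: posf.
  exact: fin_num_adde_defl.
have fval (phi psi : R -> R) : (forall x, 0 <= phi x)%R -> (forall x, 0 <= psi x)%R ->
    measurable_fun [set: R] phi -> measurable_fun [set: R] psi ->
    (forall x, `|phi x| <= `|x|)%R -> (forall x, `|psi x| <= `|x|)%R ->
    P.-integrable [set: T] (fun t => (\1_A t * (phi (X t) * psi (Y t)))%:E).
  move=> phi0 psi0 mphi mpsi phile psile.
  have m : measurable_fun [set: T] (fun t => (\1_A t * (phi (X t) * psi (Y t)))%:E).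
    apply/measurable_EFinP/measurable_funM; first exact: mind.
    by apply: measurable_funM; apply: measurableT_comp.
  apply/integrableP; split => //.
  under eq_integral => t _ do
    rewrite gee0_abs ?lee_fin ?mulr_ge0// ?indicE//.
  rewrite integral_indepM_ge0//; last exact: fin.
  rewrite lte_mul_pinfty// ?fin_num_measure//.
  rewrite lte_mul_pinfty//; last exact: finY.
    by apply: integral_ge0 => t _; rewrite lee_fin.
  rewrite ge0_fin_numE ?fin//; by apply: integral_ge0 => t _; rewrite lee_fin.
have split t : (\1_A t * (X t * Y t))%R =
  ((\1_A t * (pos (X t) * pos (Y t)) + \1_A t * (neg (X t) * neg (Y t))) -
  (\1_A t * (pos (X t) * neg (Y t)) + \1_A t * (neg (X t) * pos (Y t))))%R.
  by rewrite {1}(posneg (X t)) {1}(posneg (Y t)); ring.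
have ipp := fval pos pos pos0 pos0 mpos mpos posle posle.
have inn := fval neg neg neg0 neg0 mneg mneg negle negle.
have ipn := fval pos neg pos0 neg0 mpos mneg posle negle.
have inp := fval neg pos neg0 pos0 mneg mpos negle posle.
have i1 := integrableD measurableT ipp inn.
have i2 := integrableD measurableT ipn inp.
have -> : (fun t => (\1_A t * (X t * Y t))%:E) =
    ((fun t => (\1_A t * (pos (X t) * pos (Y t)))%:E) \+
     (fun t => (\1_A t * (neg (X t) * neg (Y t)))%:E)) \-
    ((fun t => (\1_A t * (pos (X t) * neg (Y t)))%:E) \+
     (fun t => (\1_A t * (neg (X t) * pos (Y t)))%:E)).
  by apply/funext => t /=; rewrite split EFinB 2!EFinD.
split; first exact: integrableB i1 i2.
rewrite (integralB measurableT i1 i2) !integralD//.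
rewrite !integral_indepM_ge0 ?fin// Epn.
rewrite [X in _ - X]addeC subee// fin_numD !fin_numM ?fin_num_measure//;
  by rewrite ge0_fin_numE ?fin ?finY//; apply: integral_ge0 => t _; rewrite lee_fin.
Qed.

(** Expanding the square leaves n diagonal terms, each at most v, against the factor n^(-2). The
    weight [w] is an indicator for the data and noise averages and 1 for the releases, which are
    merely uncorrelated. *)
Lemma integral_sqr_mean_le n (V : 'I_n -> T -> R) w (v : R) : (0 < n)%N ->
  (forall i, measurable_fun [set: T] (V i)) ->
  measurable_fun [set: T] w -> (forall t, 0 <= w t)%R ->
  (forall i, \int[P]_t (w t * V i t ^+ 2)%:E <= v%:E) ->
  (forall i j, i != j ->
    P.-integrable [set: T] (fun t => (w t * (V i t * V j t))%:E) /\
    \int[P]_t (w t * (V i t * V j t))%:E = 0) ->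
  \int[P]_t (w t * (n%:R^-1 * \sum_(i < n) V i t) ^+ 2)%:E <= (v / n%:R)%:E.
Proof.
move=> n0 mV mw w0 diag off.
have iij i j : P.-integrable [set: T] (fun t => (w t * (V i t * V j t))%:E).
  have [->|/off[]//] := eqVneq i j.
  apply/integrableP; split.
    by apply/measurable_EFinP; do ?apply: measurable_funM.
  apply: le_lt_trans (ltry v); apply: le_trans (diag j); rewrite le_eqVlt.
  apply/orP; left; apply/eqP; apply: eq_integral => t _.
  by rewrite gee0_abs ?expr2// lee_fin mulr_ge0// -expr2 sqr_ge0.
have -> : \int[P]_t (w t * (n%:R^-1 * \sum_(i < n) V i t) ^+ 2)%:E =
    \int[P]_t ((n%:R^-1 ^+ 2)%:E *
      \sum_(i < n) \sum_(j < n) (w t * (V i t * V j t))%:E).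
  apply: eq_integral => t _; under [in RHS]eq_bigr do rewrite sumEFin.
  rewrite sumEFin -EFinM exprMn mulrCA; congr (_ * _)%:E.
  rewrite expr2 mulr_suml mulr_sumr; apply: eq_bigr => i _.
  by rewrite !mulr_sumr.
have isum i : P.-integrable [set: T] (fun t => \sum_(j < n) (w t * (V i t * V j t))%:E).
  exact: integrable_sum.
rewrite integralZl//; last exact: integrable_sum.
rewrite integral_sum//.
apply: (@le_trans _ _ ((n%:R^-1 ^+ 2)%:E * \sum_(i < n) v%:E)).
  apply: lee_wpmul2l; first by rewrite lee_fin sqr_ge0.
  apply: lee_sum => i _; rewrite integral_sum// (bigD1 i)//= big1 ?adde0.
    by under eq_integral do rewrite -expr2; exact: diag.
  by move=> j ji; rewrite (off _ _ _).2// eq_sym.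
rewrite sumEFin sumr_const card_ord -EFinM lee_fin -(mulr_natl v).
rewrite le_eqVlt; apply/orP; left; apply/eqP.
by field; rewrite pnatr_eq0 -lt0n.
Qed.

Lemma integrable_sqr_le X (v : R) : measurable_fun [set: T] X ->
  \int[P]_t (X t ^+ 2)%:E <= v%:E -> P.-integrable [set: T] (EFin \o X).
Proof.
move=> mX EX2.
apply: (@le_integrable _ _ _ _ _ _ _ (fun t => 1 + (X t ^+ 2)%:E)) => //.
- exact/measurable_EFinP.
- move=> t _ /=; rewrite lee_fin [leRHS]ger0_norm ?addr_ge0 ?sqr_ge0//.
  rewrite -real_normK ?num_real//; have := normr_ge0 (X t).
  move: `|X t|%R => x x0; nra.
- apply: integrableD => //; first exact: finite_measure_integrable_cst.
  apply/integrableP; split.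
    by apply/measurable_EFinP; under eq_fun do rewrite expr2; exact: measurable_funM.
  apply: le_lt_trans (ltry v); apply: le_trans (EX2); rewrite le_eqVlt.
  apply/orP; left; apply/eqP; apply: eq_integral => t _.
  by rewrite gee0_abs// lee_fin sqr_ge0.
Qed.

(** The gain over Chebyshev-type bounds is the factor [P A]: with A the event x2_i = k it becomes
    p_k, which can be summed over the alphabet. *)
Lemma integral_sqr_mean_indep_le A n (V : 'I_n -> T -> R) (v : R) : (0 < n)%N ->
  measurable A -> (forall i, measurable_fun [set: T] (V i)) ->
  (forall i C, measurable C -> P (A `&` V i @^-1` C) = P A * P (V i @^-1` C)) ->
  (forall i j C D, i != j -> measurable C -> measurable D ->
    P (A `&` (V i @^-1` C `&` V j @^-1` D)) =
    P A * (P (V i @^-1` C) * P (V j @^-1` D))) ->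
  (forall i, \int[P]_t (V i t)%:E = 0) ->
  (forall i, \int[P]_t (V i t ^+ 2)%:E <= v%:E) ->
  \int[P]_t (\1_A t * (n%:R^-1 * \sum_(i < n) V i t) ^+ 2)%:E <=
  P A * (v / n%:R)%:E.
Proof.
move=> n0 mA mV ind1 ind2 EV0 EV2.
have PAfin : P A \is a fin_num by rewrite fin_num_measure.
have iV i := integrable_sqr_le (mV i) (EV2 i).
rewrite -(fineK PAfin) -EFinM mulrA.
apply: integral_sqr_mean_le => //.
- move=> i.
  have -> : \int[P]_t (\1_A t * V i t ^+ 2)%:E =
      P A * (\int[P]_t (V i t ^+ 2)%:E * \int[P]_(t in [set: T]) 1%:E).
    under eq_integral do rewrite -[(V i _ ^+ 2)%R]mulr1.
    (* Taking a constant second variable and psi = 1 turns the product rule into a statement about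
       [V i] and [A] alone. *)
    apply: (@integral_indepM_ge0 A (V i) (cst 0%R) (fun x => x ^+ 2)%R
      (fun=> 1%R)) => //.
    + by move=> x; rewrite sqr_ge0.
    + move=> C D mC mD; rewrite preimage_cst; case: ifPn => _.
        by rewrite setIT probability_setT mule1 ind1.
      by rewrite !setI0 measure0 !mule0.
    + exact: le_lt_trans (EV2 i) (ltry _).
  rewrite icst// mul1e probability_setT mule1 EFinM fineK//.
  exact: lee_wpmul2l.
- move=> i j ij; apply: integral_indepM_eq0 => //.
  by move=> C D mC mD; exact: ind2.
Qed.

End independence.

(** * The Laplace law *)

Section laplace.
Context {R : realType}.
Local Open Scope ereal_scope.
Local Notation mu := (@lebesgue_measure R).

Lemma ge0_integral_oppr (f : R -> R) :
  measurable_fun [set: R] f -> (forall x, 0 <= f x)%R ->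
  \int[mu]_x (f x)%:E = \int[mu]_x (f (- x)%R)%:E.
Proof.
move=> mf f0; rewrite -[RHS](@ge0_integral_pushforward _ _
  (measurableTypeR R) (measurableTypeR R) R -%R _ mu setT (EFin \o f))//.
- by apply: eq_measure_integral => A mA _; exact/esym/lebesgue_measureN.
- exact/measurable_EFinP.
- by move=> x _; rewrite lee_fin.
Qed.

Lemma measurable_laplace_density : measurable_fun [set: R] (@laplace_density R).
Proof.
apply: measurable_funM => //; apply: measurableT_comp => //.
exact: measurableT_comp.
Qed.

Lemma laplace_density_ge0 (x : R) : (0 <= laplace_density x)%R.
Proof. by rewrite /laplace_density divr_ge0 ?expR_ge0. Qed.

(** From exp u >= u^2 / 2 at u = |x| / 2 comes x^2 exp(-|x| / 2) <= 8; the remaining factor exp(-|x|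
    / 2) / 2 is an exponential density of rate 1/2 on each half-line. The two densities integrate to
    2, whence the second-moment bound 16, which is crude but enough. *)
Lemma laplace_density_sqr_le (x : R) : (x ^+ 2 * laplace_density x <=
  8 * (exponential_pdf 2^-1 x + exponential_pdf 2^-1 (- x)))%R.
Proof.
wlog x0 : x / (0 <= x)%R.
  move=> H; have [|/ltW x0] := leP 0%R x; first exact: H.
  have := H (- x)%R; rewrite oppr_ge0 sqrrN opprK /laplace_density normrN.
  by rewrite [X in (8 * X)%R]addrC; exact.
have half0 : (0 <= 2^-1 :> R)%R by rewrite invr_ge0.
apply: (@le_trans _ _ (8 * exponential_pdf 2^-1 x)%R); last first.
  by rewrite ler_wpM2l// lerDl exponential_pdf_ge0.
rewrite exponential_pdfE// /laplace_density ger0_norm//.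
have -> : (- x = - 2^-1 * x + - 2^-1 * x :> R)%R by field.
rewrite expRD; set e := expR _; have e0 : (0 < e)%R by exact: expR_gt0.
have : (x ^+ 2 * e <= 8)%R.
  rewrite /e mulNr expRN ler_pdivrMr ?expR_gt0//.
  have := @expR_ge1Dxn R (2^-1 * x)%R 1%N.
  by rewrite mulr_ge0// => /(_ isT); rewrite (_ : 2`! = 2%N)//; nra.
move=> h; nra.
Qed.

Section law.
Context d (T : measurableType d) (P : probability T R) (W : T -> R).
Hypothesis mW : measurable_fun [set: T] W.
Hypothesis law : forall B : set R, measurable B ->
  P (W @^-1` B) = \int[mu]_(x in B) (laplace_density x)%:E.

Lemma ge0_laplace_expectation (phi : R -> R) :
  measurable_fun [set: R] phi -> (forall x, 0 <= phi x)%R ->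
  \int[P]_t (phi (W t))%:E = \int[mu]_x (phi x * laplace_density x)%:E.
Proof.
move=> mphi phi0.
have mld := measurable_laplace_density.
rewrite -(@integral_transfer _ _ _ _ _ P mu W (cst 1%R) id
  (@laplace_density R) phi)//; first last.
- move=> C mC; rewrite -law// -[RHS]mul1e.
  have mWC : measurable (W @^-1` C) by rewrite -[X in measurable X]setTI; exact: mW.
  exact: (@integral_cst _ _ _ P _ mWC 1%E).
- exact: laplace_density_ge0.
by apply: eq_integral => t _; rewrite mulr1.
Qed.

Lemma laplace_sqr_le : \int[P]_t (W t ^+ 2)%:E <= 16%:E.
Proof.
have me : measurable_fun [set: R] (exponential_pdf (2^-1 : R)).
  exact: measurable_exponential_pdf.
have meN : measurable_fun [set: R] (fun x : R => exponential_pdf 2^-1 (- x)%R).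
  exact: measurableT_comp.
have half0 : (0 <= 2^-1 :> R)%R by rewrite invr_ge0.
rewrite (ge0_laplace_expectation (phi := fun x => x ^+ 2)%R)//; last first.
  by move=> x; rewrite sqr_ge0.
apply: (@le_trans _ _ (\int[mu]_x (8%:E * ((exponential_pdf 2^-1 x)%:E +
     (exponential_pdf 2^-1 (- x)%R)%:E)))).
  apply: ge0_le_integral => //.
  - move=> x _; rewrite lee_fin mulr_ge0 ?sqr_ge0//.
    exact: laplace_density_ge0.
  - apply/measurable_EFinP/measurable_funM => //.
    exact: measurable_laplace_density.
  - apply/measurable_EFinP; apply: measurable_funM => //.
    exact: measurable_funD.
  - by move=> x _; rewrite lee_fin laplace_density_sqr_le.
rewrite ge0_integralZl//; last first.
- by move=> x _; rewrite -EFinD lee_fin addr_ge0 ?exponential_pdf_ge0.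
- by apply/measurable_EFinP; exact: measurable_funD.
rewrite ge0_integralD//; try by apply/measurable_EFinP.
- rewrite -ge0_integral_oppr// ?integral_exponential_pdf ?invr_gt0//.
    by rewrite -EFinD -EFinM lee_fin; lra.
  by move=> x; exact: exponential_pdf_ge0.
- by move=> x _; rewrite lee_fin exponential_pdf_ge0.
- by move=> x _; rewrite lee_fin exponential_pdf_ge0.
Qed.

(** By symmetry of the density the positive and negative parts have the same mean; the second-moment
    bound makes it finite, so that the difference is 0. *)
Lemma laplace_mean_eq0 : \int[P]_t (W t)%:E = 0.
Proof.
pose pos (x : R) := Num.max x 0%R.
have mpos : measurable_fun [set: R] pos by exact: measurable_maxr.
have mld := measurable_laplace_density.
have mneg : measurable_fun [set: R] (fun x => pos (- x)%R).
  exact: measurableT_comp.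
have pos0 x : (0 <= pos x)%R by rewrite le_max lexx orbT.
have iW := integrable_sqr_le mW laplace_sqr_le.
have posneg (x : R) : (pos x - pos (- x) = x)%R.
  by rewrite /pos; case: (leP x 0%R); case: (leP (- x)%R 0%R); lra.
have iphi (phi : R -> R) : measurable_fun [set: R] phi ->
    (forall x, `|phi x| <= `|x|)%R -> P.-integrable [set: T] (EFin \o (phi \o W)).
  move=> mphi phile; apply: (le_integrable measurableT _ _ iW).
    exact/measurable_EFinP/measurableT_comp.
  by move=> t _ /=; rewrite lee_fin.
have posle x : (`|pos x| <= `|x|)%R.
  by rewrite ger0_norm// /pos; case: (leP x 0%R) => // ?; rewrite ler_norm.
have i1 := iphi _ mpos posle.
have i2 : P.-integrable [set: T] (EFin \o ((fun x => pos (- x)%R) \o W)).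
  by apply: iphi => // x; rewrite -[leRHS]normrN.
transitivity (\int[P]_t ((pos (W t))%:E - (pos (- W t)%R)%:E)).
  by apply: eq_integral => t _; rewrite -EFinB posneg.
rewrite integralB_EFin// (ge0_laplace_expectation mpos)//.
rewrite (ge0_laplace_expectation mneg)//.
rewrite ge0_integral_oppr; [|exact: measurable_funM|].
  under eq_integral do rewrite /laplace_density normrN.
  rewrite subee//; rewrite -(ge0_laplace_expectation mneg)//.
  by apply: integrable_fin_num i2.
by move=> x; rewrite mulr_ge0// laplace_density_ge0.
Qed.

End law.
End laplace.

(** * The sequentially interactive experiment *)

Section prelim.
Context d (T : measurableType d) (R : realType) (P : probability T R).
Local Open Scope ereal_scope.

Lemma mutually_independent2 (I : finType) (F : I -> set (set T)) a b
    (A B : set T) : mutually_independent P F -> a != b ->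
  F a A -> F b B -> P (A `&` B) = P A * P B.
Proof.
move=> indep ab FA FB.
have := indep [set a; b]%SET (fun i => if i == a then A else B).
have ba : (b == a) = false by rewrite eq_sym (negbTE ab).
rewrite big_setU1 ?inE//= big_set1 eqxx ba => <-.
  congr (P _); rewrite eqEsubset; split=> [t [At Bt] i /=|t /= H].
    by rewrite !inE => /orP[] /eqP ->; rewrite ?eqxx ?ba.
  split; first by have := H a; rewrite /= !inE eqxx; exact.
  by have := H b; rewrite /= !inE eqxx orbT ba; exact.
by move=> i; rewrite !inE => /orP[] /eqP ->; rewrite ?eqxx ?ba.
Qed.

Lemma mutually_independent3 (I : finType) (F : I -> set (set T)) a b c
    (A B C : set T) : mutually_independent P F -> a != b -> a != c -> b != c ->
  F a A -> F b B -> F c C -> P (A `&` (B `&` C)) = P A * (P B * P C).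
Proof.
move=> indep ab ac bc FA FB FC.
have := indep [set a; b; c]%SET
  (fun i => if i == a then A else if i == b then B else C).
have ba : (b == a) = false by rewrite eq_sym (negbTE ab).
have ca : (c == a) = false by rewrite eq_sym (negbTE ac).
have cb : (c == b) = false by rewrite eq_sym (negbTE bc).
rewrite -finset.setUA big_setU1 ?inE ?negb_or ?ab//= big_setU1 ?inE//= big_set1.
rewrite !eqxx ba ca cb => <-.
  congr (P _); rewrite eqEsubset; split=> [t [At [Bt Ct]] i /=|t /= H].
    by rewrite !inE => /or3P[] /eqP ->; rewrite ?eqxx ?ba ?ca ?cb.
  split; first by have := H a; rewrite /= !inE eqxx; exact.
  split; first by have := H b; rewrite /= !inE eqxx orbT ba; exact.
  by have := H c; rewrite /= !inE eqxx !orbT ca cb; exact.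
by move=> i; rewrite !inE => /or3P[] /eqP ->; rewrite ?eqxx ?ba ?ca ?cb.
Qed.

Lemma bounded_integrable (f : T -> R) (M : R) : measurable_fun [set: T] f ->
  (forall t, `|f t| <= M)%R -> P.-integrable [set: T] (EFin \o f).
Proof.
move=> mf fM; apply: (@le_integrable _ _ _ _ _ measurableT _ (cst M%:E)).
- exact/measurable_EFinP.
- by move=> t _ /=; rewrite lee_fin (le_trans (fM t))// ler_norm.
- exact: finite_measure_integrable_cst.
Qed.

Lemma cond_prob_integralM (G : set (set T)) (A : set T) (phi f : T -> R) :
  measurable A -> measurable_fun [set: T] phi -> (forall t, 0 <= phi t)%R ->
  (forall B, G B -> \int[P]_(t in B) (phi t)%:E = P (A `&` B)) ->
  measurable_fun [set: T] f -> (forall t, 0 <= f t)%R ->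
  (forall C : set R, measurable C -> G (f @^-1` C)) ->
  \int[P]_t (f t * \1_A t)%:E = \int[P]_t (f t * phi t)%:E.
Proof.
move=> mA mphi phi0 cond mf f0 Gf.
(* The transfer needs a test function that is nonnegative on the whole line, so the identity is
   replaced by the positive part, which agrees with it on the values of [f]. *)
pose pos (x : R) := Num.max x 0%R.
have posf t : pos (f t) = f t by rewrite /pos max_l.
transitivity (\int[P]_t (pos (f t) * \1_A t)%:E).
  by apply: eq_integral => t _; rewrite posf.
transitivity (\int[P]_t (pos (f t) * phi t)%:E); last first.
  by apply: eq_integral => t _; rewrite posf.
apply: integral_transfer => //.
- exact: measurable_maxr.
- by move=> x; rewrite le_max lexx orbT.
- move=> C mC; rewrite cond; last exact: Gf.
  rewrite integral_indic// -[X in measurable X]setTI; exact: mf.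
Qed.

End prelim.

(** * Elementary inequalities for means, clipping and the release level *)

Lemma sqr_sum_le (R : realType) n (a : 'I_n -> R) : (0 < n)%N ->
  (n%:R^-1 * \sum_(i < n) a i) ^+ 2 <= n%:R^-1 * \sum_(i < n) a i ^+ 2.
Proof.
move=> n0; have n0' : 0 < n%:R :> R by rewrite ltr0n.
rewrite exprMn expr2 -mulrA ler_wpM2l ?invr_ge0 ?ler0n// ler_pdivrMl//.
rewrite expr2 mulr_suml.
apply: (@le_trans _ _ (\sum_(i < n) \sum_(j < n) ((a i ^+ 2 + a j ^+ 2) / 2))).
  apply: ler_sum => i _; rewrite mulr_sumr; apply: ler_sum => j _.
  have := sqr_ge0 (a i - a j); lra.
under eq_bigr do rewrite -mulr_suml big_split/= sumr_const card_ord.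
rewrite -mulr_suml big_split/= sumr_const card_ord -sumrMnl -mulr_natl.
by rewrite (eq_bigr (fun i => n%:R * a i ^+ 2)) => [|i _]; rewrite ?mulr_natl// -mulr_sumr; lra.
Qed.

Lemma clip02_ge0 (R : realType) (y : R) : 0 <= clip02 y <= 2.
Proof. by rewrite /clip02 le_min le_max lexx orbT ge_min lexx orbT /=; lra. Qed.

Lemma clip02_sub_sqr_le (R : realType) (y p : R) : 0 <= p <= 2 ->
  (clip02 y - p) ^+ 2 <= (y - p) ^+ 2.
Proof.
move=> /andP[p0 p2]; rewrite /clip02.
by case: (leP y 0) => y0; case: (leP _ 2) => y2; nra.
Qed.

(** The lower bound makes the release probabilities lie in [0, 1]. The upper one fixes the size of
    the privacy noise: the ratio is 1 + 2 / (exp alpha - 1) <= 1 + 2 / alpha <= 4 / alpha. *)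
Lemma z_level_bounds (R : realType) (alpha gamma : R) : 0 < alpha < 1 ->
  2 `^ (gamma - 1) <= z_level alpha gamma /\
  z_level alpha gamma <= 2 `^ (gamma - 1) * (4 / alpha).
Proof.
move=> /andP[a0 a1]; have h := expR_ge1Dx alpha.
have e1 : 0 < expR alpha - 1 by lra.
have c0 : 0 <= 2 `^ (gamma - 1) by exact: powR_ge0.
rewrite /z_level; split.
  by rewrite ler_peMr// ler_pdivlMr//; lra.
by rewrite ler_wpM2l// ler_pdivrMr// mulrAC ler_pdivlMr//; nra.
Qed.

(** * Release probabilities and measurability *)

Section experiment.
Context d (T : measurableType d) (R : realType) (P : probability T R).
Variables (n K : nat) (alpha gamma : R) (p : 'I_K -> R).
Variables (x1 x2 : 'I_n -> T -> 'I_K) (w : 'I_n -> 'I_K -> {mfun T >-> R}).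
Variable z2 : 'I_n -> {mfun T >-> R}.
Hypotheses (n0 : (0 < n)%N) (alpha01 : 0 < alpha < 1) (gamma1 : 1 < gamma).
Hypothesis psimplex : simplex p.
Hypothesis H : si_experiment P alpha gamma p x1 x2 w z2.

Local Notation s := (gamma - 1).
Local Notation z := (z_level alpha gamma).
Local Notation g := (first_estimate alpha gamma x1 (fun i k => w i k)).
Local Notation zhat := (laplace_mean alpha x1 (fun i k => w i k)).
Local Notation F := (power_sum gamma p).
Local Notation E1 i := (z2 i @^-1` [set z]).
Local Notation X2 i k := (x2 i @^-1` [set k]).

(** The conditional probability of [E1 i], the event that individual i releases +z, given [z1] and
    [x2]. *)
Let phi i t : R := (1 + z^-1 * g (x2 i t) t) / 2.

Let s0 : 0 < s. Proof. by rewrite subr_gt0. Qed.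

Let p01 k : 0 <= p k <= 1. Proof. exact: psimplex.1. Qed.

Let z0 : 0 < z.
Proof.
have [+ _] := z_level_bounds gamma alpha01.
by apply: lt_le_trans; exact: powR_gt0.
Qed.

Let g_bounds k t : 0 <= g k t <= z.
Proof.
rewrite powR_ge0/=; have [+ _] := z_level_bounds gamma alpha01.
have /andP[c0 c2] := clip02_ge0 (zhat k t).
by apply: le_trans; rewrite ge0_ler_powR ?nnegrE// ltW.
Qed.

Let phi01 i t : 0 <= phi i t <= 1.
Proof.
have /andP[g0 gz] := g_bounds (x2 i t) t; have i0 : 0 < z^-1 by rewrite invr_gt0.
rewrite /phi; have : 0 <= z^-1 * g (x2 i t) t by rewrite mulr_ge0// ltW.
have : z^-1 * g (x2 i t) t <= 1 by rewrite ler_pdivrMl// mulr1.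
lra.
Qed.

(** The conditional mean of a release. With z2_i = z (2 1_{E1 i} - 1), the first error term becomes
    2z times the mean of the variables 1_{E1 i} - phi_i. *)
Let phiE i t : g (x2 i t) t = z * (2 * phi i t - 1).
Proof. by rewrite /phi; field; rewrite gt_eqF. Qed.

Let mpre (x : 'I_n -> T -> 'I_K) : (forall i k, measurable (x i @^-1` [set k])) ->
  forall i (C : set 'I_K), measurable (x i @^-1` C).
Proof.
move=> mx i C.
have -> : x i @^-1` C = \bigcup_(k in C) (x i @^-1` [set k]).
  apply/seteqP; split=> [t Ct|t [k Ck xk]]; first by exists (x i t).
  by rewrite /= xk.
by apply: fin_bigcup_measurable => [|k _]; [exact: finite_finset|exact: mx].
Qed.

Let mcomp (x : 'I_n -> T -> 'I_K) : (forall i k, measurable (x i @^-1` [set k])) ->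
  forall i (f : 'I_K -> R), measurable_fun [set: T] (f \o x i).
Proof.
move=> mx i f _ C mC; rewrite setTI comp_preimage; exact: mpre.
Qed.

Let mzhat k : measurable_fun [set: T] (zhat k).
Proof.
apply: measurable_funM => //; apply: measurable_sum => i.
apply: measurable_funD.
  exact: (mcomp (si_measurable_x1 H) i (fun j => (j == k)%:R)).
exact: measurable_funM.
Qed.

Let mg k : measurable_fun [set: T] (g k).
Proof.
apply: (measurableT_comp (measurable_powR s)).
apply: measurable_minr => //; exact: measurable_maxr.
Qed.

Let gx2E i t : g (x2 i t) t = \sum_(k < K) \1_(X2 i k) t * g k t.
Proof.
rewrite (bigD1 (x2 i t))//= indicE mem_set// mul1r big1 ?addr0// => k.
move=> kx; rewrite indicE memNset ?mul0r//= => xk.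
by move: kx; rewrite -xk eqxx.
Qed.

Let mgx2 i : measurable_fun [set: T] (fun t => g (x2 i t) t).
Proof.
under eq_fun do rewrite gx2E.
apply: measurable_sum => k; apply: measurable_funM => //.
exact/measurable_indic/(si_measurable_x2 H).
Qed.

Let mphi i : measurable_fun [set: T] (phi i).
Proof. by apply: measurable_funM => //; apply: measurable_funD => //; exact: measurable_funM. Qed.

Let mE1 i : measurable (E1 i).
Proof. by rewrite -[X in measurable X]setTI; exact: measurable_funPT. Qed.

Local Open Scope ereal_scope.

(** * Conditional law of the releases *)

Let G := sigma_z1_x2 alpha x1 x2 (fun i k => w i k).

Let GT : G setT.
Proof.
have [h _] := si_second_half H finset.set0 (fun=> false).
by have := h _ measurableT; rewrite preimage_setT.
Qed.

Let cond_prob_plus (J : {set 'I_n}) :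
  is_cond_prob P G (\bigcap_(i in [set` J]) E1 i) (fun t => \prod_(i in J) phi i t)%R.
Proof.
have := si_second_half H J (fun=> false).
have -> : (fun t => \prod_(i in J) phi i t)%R = (fun t => \prod_(i in J)
  ((1 + (-1) ^+ false / z * g (x2 i t) t) / 2))%R.
  by apply/funext => t; apply: eq_bigr => i _; rewrite expr0 div1r.
have -> // : \bigcap_(i in [set` J]) E1 i =
  [set t | forall i, i \in J -> z2 i t = ((-1) ^+ false * z)%R].
by rewrite expr0 mul1r; apply/seteqP; split.
Qed.

Let prod1E i : (fun t => \prod_(j in [set i]%SET) phi j t)%R = phi i.
Proof. by apply/funext => t; rewrite big_set1. Qed.

Let bigcap1E (A : 'I_n -> set T) i : \bigcap_(j in [set` [set i]%SET]) A j = A i.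
Proof.
apply/seteqP; split => t /=; first by apply; rewrite /= inE.
by move=> Ait j; rewrite /= inE => /eqP ->.
Qed.

(* The measurability clause of is_cond_prob spares a direct proof that the
   first-half estimate is measurable for the conditioning sigma-algebra. *)
Let Gphi i (C : set R) : measurable C -> G (phi i @^-1` C).
Proof. by have [h _] := cond_prob_plus [set i]%SET; move/h; rewrite prod1E. Qed.

Let cond1 i B : G B -> \int[P]_(t in B) (phi i t)%:E = P (E1 i `&` B).
Proof.
have [_ h] := cond_prob_plus [set i]%SET.
by move/h; rewrite bigcap1E => <-; apply: eq_integral => t _; rewrite big_set1.
Qed.

Let cond2 i j : i != j -> P (E1 i `&` E1 j) = \int[P]_t (phi i t * phi j t)%:E.
Proof.
move=> ij; have [_ /(_ _ GT)] := cond_prob_plus [set i; j]%SET.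
rewrite setIT; have -> : \bigcap_(k in [set` [set i; j]%SET]) E1 k = E1 i `&` E1 j.
  apply/seteqP; split => t /=.
    by move=> h; split; apply: (h); rewrite /= !inE eqxx ?orbT.
  by move=> [ti tj] k; rewrite /= !inE => /orP[] /eqP ->.
move=> <-; apply: eq_integral => t _.
by rewrite big_setU1 ?inE// big_set1.
Qed.

(** The experiment prescribes only the probabilities of the values z and -z. Since [phi i] and
    [1 - phi i] add up to 1, these two values exhaust the law of [z2 i]. *)
Let sign_ae i : {ae P, forall t, z2 i t = (z * (2 * \1_(E1 i) t - 1))%R}.
Proof.
have [_ /(_ _ GT)] := si_second_half H [set i]%SET (fun=> true).
rewrite setIT; set N := [set t | _].
have -> : N = z2 i @^-1` [set - z]%R.
  apply/seteqP; split => t /=; first by move/(_ i); rewrite inE eqxx expr1 mulN1r; exact.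
  by move=> zt j; rewrite inE expr1 mulN1r => /eqP ->.
have mN : measurable (z2 i @^-1` [set - z]%R).
  by rewrite -[X in measurable X]setTI; exact: measurable_funPT.
have -> : \int[P]_t (\prod_(j in [set i]%SET)
    ((1 + (-1) ^+ true / z * g (x2 j t) t) / 2))%:E =
    \int[P]_t (1 - phi i t)%:E.
  apply: eq_integral => t _; rewrite big_set1 expr1; congr EFin.
  by rewrite /phi; field; rewrite gt_eqF.
move=> hN; have hP := cond1 i GT; rewrite setIT in hP.
have iphi : P.-integrable setT (EFin \o phi i).
  apply: (bounded_integrable P (M := 1%R)) => // t.
  by have /andP[a b] := phi01 i t; rewrite ger0_norm.
have tot : P (E1 i `|` z2 i @^-1` [set - z]%R) = 1.
  rewrite measureU//; last first.
    rewrite -subset0 => t [/= -> zz]; have := z0; lra.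
  transitivity (\int[P]_t (phi i t)%:E + \int[P]_t (1 - phi i t)%:E).
    by rewrite hP hN.
  rewrite -integralD_EFin//.
    transitivity (\int[P]_(t in setT) (1%R : R)%:E).
      by apply: eq_integral => t _; rewrite -EFinD addrC subrK.
    transitivity (1 * P [set: T]); last by rewrite probability_setT mule1.
    exact: (@integral_cst _ _ _ P _ measurableT 1%E).
  rewrite /comp; under eq_fun do rewrite EFinB.
  by apply: integrableB => //; exact: finite_measure_integrable_cst.
exists (~` (E1 i `|` z2 i @^-1` [set - z]%R)); split.
- exact/measurableC/measurableU.
- by rewrite probability_setC ?tot ?subee//; exact: measurableU.
- move=> t /= hn [zt|zt]; apply: hn.
    by rewrite indicE mem_set//= zt; ring.
  rewrite indicE memNset /=; first by rewrite zt; ring.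
  by rewrite zt => e; have := z0; lra.
Qed.

(** * Second moments of the data, noise and release averages *)

Let data_expectation (y : T -> 'I_K) (f : 'I_K -> R) :
  (forall k, measurable (y @^-1` [set k])) ->
  (forall k, P (y @^-1` [set k]) = (p k)%:E) ->
  \int[P]_t (f (y t))%:E = (\sum_(k < K) p k * f k)%:E.
Proof.
move=> my lawy.
have ik k : P.-integrable [set: T] (fun t => (f k * \1_(y @^-1` [set k]) t)%:E).
  apply: (bounded_integrable P (M := `|f k|%R)).
    by apply: measurable_funM => //; exact: measurable_indic.
  by move=> t; rewrite normrM ler_piMr// indicE ger0_norm// lern1 leq_b1.
transitivity (\int[P]_t \sum_(k < K) (f k * \1_(y @^-1` [set k]) t)%:E).
  apply: eq_integral => t _; rewrite (bigD1 (y t))//= indicE mem_set// mulr1.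
  rewrite big1 ?adde0// => k kx; rewrite indicE memNset ?mulr0//= => yk.
  by move: kx; rewrite -yk eqxx.
rewrite integral_sum// -sumEFin; apply: eq_bigr => k _.
under eq_integral do rewrite EFinM.
rewrite integralZl//; last exact: integrable_indic.
rewrite mulrC EFinM -lawy; congr (_ * _).
by rewrite integral_indic// setIT.
Qed.

Let data_mean_sqr_le (A : set T) (x : 'I_n -> T -> 'I_K) (f : 'I_K -> R) :
  measurable A ->
  (forall i k, measurable (x i @^-1` [set k])) ->
  (forall i k, P (x i @^-1` [set k]) = (p k)%:E) ->
  (forall i C, P (A `&` x i @^-1` C) = P A * P (x i @^-1` C)) ->
  (forall i j C D, i != j -> P (A `&` (x i @^-1` C `&` x j @^-1` D)) =
    P A * (P (x i @^-1` C) * P (x j @^-1` D))) ->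
  (\sum_(k < K) p k * f k = 0)%R -> (forall k, `|f k| <= 1)%R ->
  \int[P]_t (\1_A t * (n%:R^-1 * \sum_(i < n) f (x i t)) ^+ 2)%:E <=
  P A * (1 / n%:R)%:E.
Proof.
move=> mA mx lawx ind1 ind2 f0 f1.
apply: (integral_sqr_mean_indep_le (V := fun i t => f (x i t))) => //.
- by move=> i; exact: (mcomp mx i f).
- by move=> i C mC; exact: (ind1 i (f @^-1` C)).
- by move=> i j C D ij mC mD; exact: (ind2 i j (f @^-1` C) (f @^-1` D)).
- by move=> i; rewrite data_expectation// f0.
- move=> i; rewrite (data_expectation (fun k => f k ^+ 2)%R)// lee_fin.
  rewrite -psimplex.2; apply: ler_sum => k _.
  rewrite ler_piMr//; first by have /andP[] := p01 k.
  by rewrite -real_normK ?num_real// expr_le1.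
Qed.

Let discreteE (y : T -> 'I_K) C : sigma_discrete y (y @^-1` C).
Proof. by exists C => //; rewrite setTI. Qed.

Let discreteT (y : T -> 'I_K) : sigma_discrete y setT.
Proof. by rewrite -(preimage_setT y); exact: discreteE. Qed.

Let realE (y : T -> R) (C : set R) : measurable C -> sigma_real y (y @^-1` C).
Proof. by exists C => //; rewrite setTI. Qed.

Let indep := si_independent H.

(** The event x2_i = k belongs to the second half, hence is independent of [x1]; it enters only
    through its probability p_k. *)
Let first_moment_bound i k :
  \int[P]_t (\1_(X2 i k) t *
    (n%:R^-1 * \sum_(j < n) ((x1 j t == k)%:R - p k)) ^+ 2)%:E <=
  (p k)%:E * (1 / n%:R)%:E.
Proof.
rewrite -(si_law_x2 H i k).
apply: (data_mean_sqr_le (f := fun l => ((l == k)%:R - p k)%R)).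
- exact: (si_measurable_x2 H).
- exact: (si_measurable_x1 H).
- exact: (si_law_x1 H).
- move=> j C; apply: (mutually_independent2 (a := inl (inr i)) (b := inl (inl j)) indep) => //;
    exact: discreteE.
- move=> j l C D jl; apply: (mutually_independent3 (a := inl (inr i))
    (b := inl (inl j)) (c := inl (inl l)) indep) => //; exact: discreteE.
- under eq_bigr do rewrite mulrBr.
  rewrite sumrB -mulr_suml psimplex.2 mul1r (bigD1 k)//= eqxx mulr1.
  by rewrite big1 ?addr0 ?subrr// => j /negbTE ->; rewrite mulr0.
- move=> l; have /andP[a b] := p01 k.
  by case: (l == k); rewrite /= ler_norml; apply/andP; split; lra.
Qed.

Let noise_moment_bound i k :
  \int[P]_t (\1_(X2 i k) t * (n%:R^-1 * \sum_(j < n) w j k t) ^+ 2)%:E <=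
  (p k)%:E * (16 / n%:R)%:E.
Proof.
rewrite -(si_law_x2 H i k).
apply: (integral_sqr_mean_indep_le (V := fun j t => w j k t)) => //.
- exact: (si_measurable_x2 H).
- move=> j C mC; apply: (mutually_independent2 (a := inl (inr i))
    (b := inr (j, k)) indep) => //; [exact: discreteE|exact: realE].
- move=> j l C D jl mC mD; apply: (mutually_independent3 (a := inl (inr i))
    (b := inr (j, k)) (c := inr (l, k)) indep) => //;
    [|exact: discreteE|exact: realE|exact: realE].
  by apply: contra jl => /eqP[->].
- by move=> j; apply: laplace_mean_eq0 => // B mB; exact: (si_law_w H).
- by move=> j; apply: laplace_sqr_le => // B mB; exact: (si_law_w H).
Qed.

Let q k := (p k `^ s)%R.

Let q01 k : (0 <= q k <= 1)%R.
Proof. by have /andP[a b] := p01 k; rewrite powR_ge0 powR_le1// ltW. Qed.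

Let sum_pq : (\sum_(k < K) p k * q k = F)%R.
Proof.
apply: eq_bigr => k _; have /andP[p0 _] := p01 k.
have [->|pn0] := eqVneq (p k) 0%R.
  by rewrite mul0r powR0// gt_eqF// (lt_trans ltr01).
have e : (p k `^ (1 + s) = p k `^ 1 * p k `^ s)%R.
  by apply: powRD; rewrite pn0 implybT.
by move: e; rewrite addrC subrK => ->; rewrite powRr1.
Qed.

Let target_bound :
  \int[P]_t ((n%:R^-1 * \sum_(i < n) (q (x2 i t) - F)) ^+ 2)%:E <= (1 / n%:R)%:E.
Proof.
(* A dummy index: independence of a pair is read off the rule for triples, with the whole space as
   an event of the sigma-algebra of [x1 i0]. *)
have i0 : 'I_n by exact: Ordinal n0.
under eq_integral => t _.
  rewrite -[X in X%:E]mul1r -[X in (X * _)%R](_ : \1_[set: T] t = 1%R); last first.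
    by rewrite indicE in_setT.
  over.
rewrite -[leRHS]mul1e -(probability_setT P).
apply: (data_mean_sqr_le (f := fun k => (q k - F)%R)) => //.
- exact: (si_measurable_x2 H).
- exact: (si_law_x2 H).
- by move=> j C; rewrite setTI probability_setT mul1e.
- move=> j l C D jl.
  apply: (mutually_independent3 (a := inl (inl i0)) (b := inl (inr j))
    (c := inl (inr l)) indep) => //; [exact: discreteT|exact: discreteE|exact: discreteE].
- under eq_bigr do rewrite mulrBr.
  by rewrite sumrB sum_pq -mulr_suml psimplex.2 mul1r subrr.
- move=> k; have /andP[a b] := q01 k.
  have F0 : (0 <= F)%R by apply: sumr_ge0 => j _; exact: powR_ge0.
  have F1 : (F <= 1)%R.
    rewrite -sum_pq -psimplex.2; apply: ler_sum => j _.
    by have /andP[? ?] := q01 j; have /andP[? ?] := p01 j; rewrite ler_piMr.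
  move: (q k) F a b F0 F1 => x y xge0 xle1 yge0 yle1.
  by rewrite ler_norml; apply/andP; split; lra.
Qed.

(** All four terms in the expansion of a cross moment have the same integral, that of phi_i phi_j:
    the product of indicators by the joint conditional law, the mixed terms by conditioning one
    release at a time. *)
Let sign_bound :
  \int[P]_t ((n%:R^-1 * \sum_(i < n) (\1_(E1 i) t - phi i t)) ^+ 2)%:E <= (1 / n%:R)%:E.
Proof.
have mD i : measurable_fun [set: T] (fun t => \1_(E1 i) t - phi i t)%R.
  by apply: measurable_funB => //; exact: measurable_indic.
have D1 i t : (`|\1_(E1 i) t - phi i t| <= 1)%R.
  have /andP[a b] := phi01 i t.
  by rewrite indicE; case: (t \in _); rewrite ler_norml; apply/andP; split; rewrite /=; lra.
under eq_integral do rewrite -[X in X%:E]mul1r.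
apply: (integral_sqr_mean_le (V := fun i t => (\1_(E1 i) t - phi i t)%R) (w := cst 1%R)) => //.
- move=> i.
  apply: (@le_trans _ _ (1 * P [set: T])); last by rewrite probability_setT mule1.
  rewrite -(@integral_cst _ _ _ P _ measurableT 1%E).
  apply: ge0_le_integral => //.
  + by move=> t _; rewrite lee_fin mul1r sqr_ge0.
  + apply/measurable_EFinP; apply: measurable_funM => //.
    by under eq_fun do rewrite expr2; exact: measurable_funM.
  + move=> t _; rewrite lee_fin mul1r -real_normK ?num_real//.
    by rewrite expr_le1.
- move=> i j ij.
  have bint (f : T -> R) : measurable_fun [set: T] f -> (forall t, 0 <= f t <= 1)%R ->
      P.-integrable [set: T] (EFin \o f).
    move=> mf f01; apply: (bounded_integrable P (M := 1%R)) => // t.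
    by have /andP[a b] := f01 t; rewrite ger0_norm.
  pose a k t : R := \1_(E1 k) t.
  have ma k : measurable_fun [set: T] (a k) by exact: measurable_indic.
  have a01 k t : (0 <= a k t <= 1)%R by rewrite /a indicE ler0n lern1 leq_b1.
  have prod01 (x y : R) : (0 <= x <= 1 -> 0 <= y <= 1 -> 0 <= x * y <= 1)%R.
    by move=> /andP[? ?] /andP[? ?]; rewrite mulr_ge0//= mulr_ile1.
  have i1 := bint (fun t => a i t * a j t)%R
    (measurable_funM (ma i) (ma j)) (fun t => prod01 _ _ (a01 i t) (a01 j t)).
  have i2 := bint (fun t => phi j t * a i t)%R
    (measurable_funM (mphi j) (ma i)) (fun t => prod01 _ _ (phi01 j t) (a01 i t)).
  have i3 := bint (fun t => phi i t * a j t)%R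
    (measurable_funM (mphi i) (ma j)) (fun t => prod01 _ _ (phi01 i t) (a01 j t)).
  have i4 := bint (fun t => phi i t * phi j t)%R
    (measurable_funM (mphi i) (mphi j)) (fun t => prod01 _ _ (phi01 i t) (phi01 j t)).
  have e1 : \int[P]_t (a i t * a j t)%:E = \int[P]_t (phi i t * phi j t)%:E.
    rewrite -cond2//; transitivity (\int[P]_t (\1_(E1 i `&` E1 j) t)%:E).
      by apply: eq_integral => t _; rewrite indicI.
    by rewrite integral_indic ?setIT//; exact: measurableI.
  (* [phi l] is [G]-measurable, so inside the integral the indicator of [E1 k] may be replaced by
     its conditional probability. *)
  have swap (k l : 'I_n) : \int[P]_t (phi l t * a k t)%:E = \int[P]_t (phi l t * phi k t)%:E.
    apply: (cond_prob_integralM (G := G)) => //.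
    + by move=> t; have /andP[] := phi01 k t.
    + exact: cond1.
    + by move=> t; have /andP[] := phi01 l t.
    + exact: Gphi.
  have -> : (fun t => (cst 1%R t * ((\1_(E1 i) t - phi i t) * (\1_(E1 j) t - phi j t)))%:E) =
    ((fun t => (a i t * a j t)%:E) \+ (fun t => (phi i t * phi j t)%:E)) \-
    ((fun t => (phi j t * a i t)%:E) \+ (fun t => (phi i t * a j t)%:E)).
    apply/funext => t /=; rewrite -!EFinD; congr EFin.
    by rewrite /a; ring.
  have i14 := integrableD measurableT i1 i4.
  have i23 := integrableD measurableT i2 i3.
  split; first exact: integrableB i14 i23.
  rewrite (integralB measurableT i14 i23) !integralD// e1 !swap.
  under [X in _ - (X + _)]eq_integral do rewrite mulrC.
  rewrite subee// fin_numD andbb.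
  by apply: integrable_fin_num i4.
Qed.

(** * Error of the first-half estimate *)

Local Notation m := (alpha ^+ 2 * n%:R)%R.
Hypothesis m1 : (1 <= m)%R.
Variable C : R.
Hypothesis C0 : (0 < C)%R.
Let rho : R := ((m `^ Num.min s 1)^-1)%R.
Hypothesis CP : forall a b : R, (0 <= a <= 2)%R -> (0 <= b <= 2)%R ->
  ((a `^ s - b `^ s) ^+ 2 <= C * (rho * (1 + m * (a - b) ^+ 2)))%R.

Let U k t : R := (n%:R^-1 * \sum_(j < n) ((x1 j t == k)%:R - p k))%R.
Let W k t : R := (n%:R^-1 * \sum_(j < n) w j k t)%R.

Let n0R : (0 < n%:R :> R)%R. Proof. by rewrite ltr0n. Qed.
Let m0 : (0 < m)%R. Proof. exact: lt_le_trans m1. Qed.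
Let rho0 : (0 <= rho)%R. Proof. by rewrite invr_ge0 powR_ge0. Qed.

Let zhat_sub k t : (zhat k t - p k = U k t + 2 / alpha * W k t)%R.
Proof.
rewrite /laplace_mean /U /W big_split/= sumrB sumr_const card_ord -mulr_sumr.
rewrite -(mulr_natl (p k)); move: (\sum_(i < n) _)%R (\sum_(i < n) w i k t)%R => a b.
by field; rewrite gt_eqF//=; have /andP[/gt_eqF -> _] := alpha01.
Qed.

(** A majorant of 1 + m (zhat_k - p_k)^2 on the event x2_i = k. It comes from zhat_k - p_k = U_k +
    (2 / alpha) W_k and (a + b)^2 <= 2 a^2 + 2 b^2, whence the coefficients 2m and 8m / alpha^2. *)
Let gain i k t : R := (\1_(X2 i k) t +
  (2 * m * (\1_(X2 i k) t * U k t ^+ 2) +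
   8 * m / alpha ^+ 2 * (\1_(X2 i k) t * W k t ^+ 2)))%R.

Let indic0 (A : set T) t : (0 <= \1_A t :> R)%R.
Proof. by rewrite indicE. Qed.

Let c2_ge0 : (0 <= 2 * m)%R. Proof. by rewrite mulr_ge0// ltW. Qed.
Let c8_ge0 : (0 <= 8 * m / alpha ^+ 2)%R.
Proof. by rewrite divr_ge0 ?sqr_ge0// mulr_ge0// ltW. Qed.

Let sqr_indic_ge0 (A : set T) (x : R) t : (0 <= \1_A t * x ^+ 2 :> R)%R.
Proof. by rewrite mulr_ge0// sqr_ge0. Qed.

Let gain_ge0 i k t : (0 <= gain i k t)%R.
Proof. by rewrite /gain addr_ge0// addr_ge0// mulr_ge0. Qed.

Let mU k : measurable_fun [set: T] (U k).
Proof.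
apply: measurable_funM => //; apply: measurable_sum => j.
exact: (mcomp (si_measurable_x1 H) j (fun l => (l == k)%:R - p k)%R).
Qed.

Let mW k : measurable_fun [set: T] (W k).
Proof. by apply: measurable_funM => //; apply: measurable_sum. Qed.

Let mIsq (A : set T) (X : T -> R) : measurable A -> measurable_fun [set: T] X ->
  measurable_fun [set: T] (fun t => \1_A t * X t ^+ 2)%R.
Proof.
move=> mA mX; apply: measurable_funM; first exact: measurable_indic.
by under eq_fun do rewrite expr2; exact: measurable_funM.
Qed.

Let mgain i k : measurable_fun [set: T] (gain i k).
Proof.
have mX := si_measurable_x2 H i k.
apply: measurable_funD; first exact: measurable_indic.
by apply: measurable_funD; apply: measurable_funM => //; exact: mIsq.
Qed.

(** Since m = alpha^2 n, the three terms contribute 1, 2m / n = 2 alpha^2 and (8m / alpha^2) (16 /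
    n) = 128 times p_k; their sum 129 + 2 alpha^2 is at most 131. *)
Let gain_bound i k : \int[P]_t (gain i k t)%:E <= (131 * p k)%:E.
Proof.
have mX := si_measurable_x2 H i k.
have [i1 i2] := (mIsq mX (mU k), mIsq mX (mW k)).
have mI : measurable_fun [set: T] (fun t => (\1_(X2 i k) t)%:E : \bar R).
  exact/measurable_EFinP/measurable_indic.
have mA := measurable_funM (@measurable_cst _ _ _ _ [set: T] (2 * m)%R) i1.
have mB := measurable_funM
  (@measurable_cst _ _ _ _ [set: T] (8 * m / alpha ^+ 2)%R) i2.
have A0 t : (0 <= 2 * m * (\1_(X2 i k) t * U k t ^+ 2))%R by rewrite mulr_ge0.
have B0 t : (0 <= 8 * m / alpha ^+ 2 * (\1_(X2 i k) t * W k t ^+ 2))%R.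
  by rewrite mulr_ge0.
rewrite /gain; under eq_integral do rewrite EFinD.
rewrite ge0_integralD//; last 2 first.
- by move=> t _; rewrite lee_fin addr_ge0.
- exact/measurable_EFinP/measurable_funD.
under [X in _ + X]eq_integral do rewrite EFinD.
rewrite ge0_integralD//; try exact/measurable_EFinP.
under [X in _ + (X + _)]eq_integral do rewrite EFinM.
under [X in _ + (_ + X)]eq_integral do rewrite EFinM.
rewrite !ge0_integralZl ?lee_fin//; try by move=> t _; rewrite lee_fin.
- rewrite integral_indic// setIT.
  apply: (@le_trans _ _ ((p k)%:E + ((2 * m)%:E * ((p k)%:E * (1 / n%:R)%:E) +
    (8 * m / alpha ^+ 2)%:E * ((p k)%:E * (16 / n%:R)%:E)))).
    apply: leeD; first by rewrite -(si_law_x2 H i k).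
    by apply: leeD; apply: lee_wpmul2l; rewrite ?lee_fin.
  rewrite -!EFinM -!EFinD lee_fin.
  have /andP[a0 a1] := alpha01; have /andP[p0 _] := p01 k.
  have -> : (p k + (2 * m * (p k * (1 / n%:R)) +
    8 * m / alpha ^+ 2 * (p k * (16 / n%:R))) = (129 + 2 * alpha ^+ 2) * p k)%R.
    by field; rewrite !gt_eqF.
  rewrite ler_wpM2r//; have : (alpha ^+ 2 <= 1)%R by rewrite expr_le1// ltW.
  lra.
- exact/measurable_EFinP.
- exact/measurable_EFinP.
- by move=> t _; rewrite lee_fin.
- by move=> t _; rewrite lee_fin.
Qed.

(** Summing over all letters replaces the random index x2_i by a deterministic one, since the
    indicator inside [gain] selects the letter. The means 131 p_k then sum to 131, whatever the
    alphabet. *)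
Let middle t : R := (n%:R^-1 * \sum_(i < n) \sum_(k < K) C * (rho * gain i k t))%R.

Let middle_ge0 t : (0 <= middle t)%R.
Proof.
rewrite mulr_ge0 ?invr_ge0 ?ler0n//; apply: sumr_ge0 => i _; apply: sumr_ge0 => k _.
by rewrite !mulr_ge0// ltW.
Qed.

Let mmiddle : measurable_fun [set: T] middle.
Proof.
apply: measurable_funM => //; apply: measurable_sum => i; apply: measurable_sum => k.
by do 2 apply: measurable_funM => //.
Qed.

Let middle_bound : \int[P]_t (middle t)%:E <= (131 * C * rho)%:E.
Proof.
have -> : \int[P]_t (middle t)%:E = \int[P]_t ((n%:R^-1 * C * rho)%:E *
    \sum_(i < n) \sum_(k < K) (gain i k t)%:E).
  apply: eq_integral => t _; under [in RHS]eq_bigr do rewrite sumEFin.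
  rewrite sumEFin -EFinM /middle -!mulrA; congr (_ * _)%:E.
  rewrite mulr_sumr mulr_sumr; apply: eq_bigr => i _.
  by rewrite 2!mulr_sumr; apply: eq_bigr.
have ms i : measurable_fun [set: T] (fun t => \sum_(k < K) (gain i k t)%:E).
  by apply: emeasurable_sum => k; exact/measurable_EFinP.
have s_ge0 i t : 0 <= \sum_(k < K) (gain i k t)%:E.
  by apply: sume_ge0 => k _; rewrite lee_fin.
rewrite ge0_integralZl//; first last.
- by rewrite lee_fin !mulr_ge0// ?invr_ge0 ?ler0n// ltW.
- by move=> t _; apply: sume_ge0 => i _.
- exact: emeasurable_sum.
rewrite ge0_integral_sum//.
apply: (@le_trans _ _ ((n%:R^-1 * C * rho)%:E * \sum_(i < n) 131%:E)).
  apply: lee_wpmul2l; first by rewrite lee_fin !mulr_ge0// ?invr_ge0 ?ler0n// ltW.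
  apply: lee_sum => i _; rewrite ge0_integral_sum//; last 2 first.
  - by move=> k; exact/measurable_EFinP.
  - by move=> k t _; rewrite lee_fin.
  apply: (@le_trans _ _ (\sum_(k < K) (131 * p k)%:E)); first exact: lee_sum.
  by rewrite sumEFin -mulr_sumr psimplex.2 mulr1.
rewrite sumEFin sumr_const card_ord -EFinM lee_fin -(mulr_natl (131%:R : R)).
rewrite le_eqVlt; apply/orP; left; apply/eqP; by field; rewrite gt_eqF.
Qed.

Let middle_dom t :
  ((n%:R^-1 * \sum_(i < n) (g (x2 i t) t - q (x2 i t))) ^+ 2 <= middle t)%R.
Proof.
apply: le_trans (sqr_sum_le _ n0) _.
rewrite ler_wpM2l ?invr_ge0 ?ler0n//; apply: ler_sum => i _.
rewrite (bigD1 (x2 i t))//= ler_wpDr//.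
  by apply: sumr_ge0 => k _; rewrite !mulr_ge0// ltW.
set k := x2 i t.
have Ik : \1_(X2 i k) t = 1%R :> R by rewrite indicE mem_set.
have /andP[pk0 pk1] := p01 k.
have p2 : (0 <= p k <= 2)%R by rewrite pk0 (le_trans pk1)// ler1n.
(* Clipping puts the estimate into [0, 2], where the modulus holds; as p_k lies there too, clipping
   does not increase the distance to p_k. *)
apply: le_trans (CP (clip02_ge0 (zhat k t)) p2) _.
rewrite ler_wpM2l ?(ltW C0)// ler_wpM2l// /gain Ik !mul1r lerD2l.
apply: (@le_trans _ _ (m * (zhat k t - p k) ^+ 2)%R).
  by rewrite ler_wpM2l ?(ltW m0)// clip02_sub_sqr_le.
rewrite zhat_sub.
have -> : (2 * m * U k t ^+ 2 + 8 * m / alpha ^+ 2 * W k t ^+ 2 =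
  m * (2 * U k t ^+ 2 + 2 * (2 / alpha * W k t) ^+ 2))%R.
  by field; have /andP[/gt_eqF -> _] := alpha01.
rewrite ler_wpM2l ?(ltW m0)//.
have := sqr_ge0 (U k t - 2 / alpha * W k t); lra.
Qed.

(** * Assembling the risk bound *)

Let S1 t : R := (n%:R^-1 * \sum_(i < n) (\1_(E1 i) t - phi i t))%R.
Let S3 t : R := (n%:R^-1 * \sum_(i < n) (q (x2 i t) - F))%R.

Let risk_dom : {ae P, forall t, [set: T] t ->
  ((si_estimator (fun i => z2 i) t - F) ^+ 2)%:E <=
  (3 * (4 * z ^+ 2 * S1 t ^+ 2 + (middle t + S3 t ^+ 2)))%:E}.
Proof.
have : {ae P, forall t, forall i, z2 i t = (z * (2 * \1_(E1 i) t - 1))%R}.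
  exact: filter_forall sign_ae.
apply: filterS => t ht _; rewrite lee_fin.
have -> : (si_estimator (fun i => z2 i) t - F = 2 * z * S1 t +
    (n%:R^-1 * \sum_(i < n) (g (x2 i t) t - q (x2 i t)) + S3 t))%R.
  have S3E : (S3 t = n%:R^-1 * \sum_(i < n) q (x2 i t) - F)%R.
    rewrite /S3 sumrB mulrBr sumr_const card_ord -(mulr_natl F).
    by rewrite mulKf// gt_eqF.
  have zE : (\sum_(i < n) z2 i t = 2 * z * \sum_(i < n) (\1_(E1 i) t - phi i t) +
      (\sum_(i < n) (g (x2 i t) t - q (x2 i t)) + \sum_(i < n) q (x2 i t)))%R.
    rewrite mulr_sumr -!big_split/=; apply: eq_bigr => i _.
    by rewrite ht phiE; ring.
  by rewrite /si_estimator zE S3E /S1; ring.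
(* This is (a + b + c)^2 <= 3 (a^2 + b^2 + c^2), with the middle square already dominated by
   [middle]. *)
have := middle_dom t; move: (n%:R^-1 * _)%R (S1 t) (S3 t) (middle t) => b a c M bM.
have := sqr_ge0 (2 * z * a - b); have := sqr_ge0 (2 * z * a - c).
have := sqr_ge0 (b - c); lra.
Qed.

Lemma quadratic_risk_le : quadratic_risk P gamma p (fun i => z2 i) <=
  (3 * (64 * (2 `^ s) ^+ 2 + 131 * C + 1) * rho)%:E.
Proof.
rewrite /quadratic_risk unlock.
have mS1 : measurable_fun [set: T] S1.
  apply: measurable_funM => //; apply: measurable_sum => i.
  by apply: measurable_funB => //; exact: measurable_indic.
have mS3 : measurable_fun [set: T] S3.
  apply: measurable_funM => //; apply: measurable_sum => i.
  exact: (mcomp (si_measurable_x2 H) i (fun k => q k - F)%R).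
have msq (X : T -> R) : measurable_fun [set: T] X ->
    measurable_fun [set: T] (fun t => X t ^+ 2)%R.
  by move=> mX; under eq_fun do rewrite expr2; exact: measurable_funM.
have z2_ge0 : (0 <= 4 * z ^+ 2)%R by rewrite mulr_ge0// sqr_ge0.
apply: (@le_trans _ _ (\int[P]_t
  (3 * (4 * z ^+ 2 * S1 t ^+ 2 + (middle t + S3 t ^+ 2)))%:E)).
  apply: ae_ge0_le_integral => //.
  - by move=> t _; rewrite lee_fin sqr_ge0.
  - apply/measurable_EFinP/msq/measurable_funB => //.
    by apply: measurable_funM => //; exact: measurable_sum.
  - by move=> t _; rewrite lee_fin !mulr_ge0// !addr_ge0// ?sqr_ge0// mulr_ge0// sqr_ge0.
  - apply/measurable_EFinP; apply: measurable_funM => //.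
    by apply: measurable_funD; [apply: measurable_funM => //; exact: msq|
      apply: measurable_funD => //; exact: msq].
under eq_integral do rewrite EFinM.
rewrite ge0_integralZl//; last 2 first.
- apply/measurable_EFinP.
  by apply: measurable_funD; [apply: measurable_funM => //; exact: msq|
      apply: measurable_funD => //; exact: msq].
- by move=> t _; rewrite lee_fin !addr_ge0// ?sqr_ge0// mulr_ge0// sqr_ge0.
rewrite -mulrA [leRHS]EFinM; apply: lee_wpmul2l; first by rewrite lee_fin.
under eq_integral do rewrite EFinD.
rewrite ge0_integralD//; last 4 first.
- by move=> t _; rewrite lee_fin mulr_ge0// sqr_ge0.
- by apply/measurable_EFinP; apply: measurable_funM => //; exact: msq.
- by move=> t _; rewrite lee_fin addr_ge0// sqr_ge0.
- by apply/measurable_EFinP; apply: measurable_funD => //; exact: msq.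
under [X in X + _]eq_integral do rewrite EFinM.
under [X in _ + X]eq_integral do rewrite EFinD.
rewrite ge0_integralD//; last 4 first.
- by move=> t _; rewrite lee_fin.
- exact/measurable_EFinP.
- by move=> t _; rewrite lee_fin sqr_ge0.
- exact/measurable_EFinP/msq.
rewrite ge0_integralZl//; last 2 first.
- exact/measurable_EFinP/msq.
- by move=> t _; rewrite lee_fin sqr_ge0.
apply: (@le_trans _ _ ((4 * z ^+ 2)%:E * (1 / n%:R)%:E +
    ((131 * C * rho)%:E + (1 / n%:R)%:E))).
  apply: leeD; first by apply: lee_wpmul2l => //; exact: sign_bound.
  by apply: leeD; [exact: middle_bound|exact: target_bound].
rewrite -EFinM -!EFinD lee_fin.
(* As m >= 1 and the exponent min(s, 1) is at most 1, the O(1/m) terms are absorbed by [rho]. *)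
have mrho : (m^-1 <= rho)%R.
  rewrite /rho lef_pV2 ?posrE ?powR_gt0//.
  by rewrite ler1_powR// ge_min lexx orbT.
have /andP[a0 a1] := alpha01.
have nm : (1 / n%:R <= m^-1)%R.
  by rewrite div1r lef_pV2 ?posrE// ler_piMl ?expr_le1// ltW.
have [zlo zhi] := z_level_bounds gamma alpha01.
have zn : (4 * z ^+ 2 * (1 / n%:R) <= 64 * (2 `^ s) ^+ 2 * m^-1)%R.
  (* The constant 64 is 4 times 4^2: the first from the factor 2z in front of [S1], the second from
     z <= 2^s (4 / alpha). *)
  have -> : (64 * (2 `^ s) ^+ 2 * m^-1 = 4 * (2 `^ s * (4 / alpha)) ^+ 2 * (1 / n%:R))%R.
    by field; rewrite !gt_eqF.
  rewrite ler_wpM2r ?divr_ge0 ?ler0n// ler_wpM2l// ler_pXn2r// nnegrE; first exact: ltW.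
  exact: le_trans (ltW z0) zhi.
have : (64 * (2 `^ s) ^+ 2 * m^-1 <= 64 * (2 `^ s) ^+ 2 * rho)%R.
  by rewrite ler_wpM2l// mulr_ge0// sqr_ge0.
lra.
Qed.

End experiment.

(** The order of quantifiers is the content: the constant is fixed from gamma alone, before the
    alphabet, the sample size, the privacy level and the experiment. *)
Lemma quadratic_risk_le_rate (R : realType) (gamma : R) : 1 < gamma ->
  exists C : R, 0 < C /\
  forall (K n : nat) (alpha : R) (p : 'I_K -> R) (d : measure_display)
    (T : measurableType d) (P : probability T R) (x1 x2 : 'I_n -> T -> 'I_K)
    (w : 'I_n -> 'I_K -> {mfun T >-> R}) (z2 : 'I_n -> {mfun T >-> R}),
  (0 < n)%N -> 0 < alpha < 1 -> 1 <= alpha ^+ 2 * n%:R ->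
  simplex p -> si_experiment P alpha gamma p x1 x2 w z2 ->
  (quadratic_risk P gamma p (fun i => z2 i) <=
   (C * ((alpha ^+ 2 * n%:R) `^ Num.min (gamma - 1) 1)^-1)%:E)%E.
Proof.
move=> gamma1; have s0 : 0 < gamma - 1 by rewrite subr_gt0.
have [C [C0 CP]] := powR_sub_sqr_le s0.
exists (3 * (64 * (2 `^ (gamma - 1)) ^+ 2 + 131 * C + 1)); split.
  by rewrite mulr_gt0// ltr_wpDl// addr_ge0// mulr_ge0 ?sqr_ge0// ltW.
move=> K n alpha p d T P x1 x2 w z2 n0 alpha01 m1 psimplex H.
by apply: (quadratic_risk_le n0 alpha01 gamma1 psimplex H m1 C0) => a b ha hb; exact: CP.
Qed.

Theorem theorem2p4 (R : realType) (gamma : R) (hgamma : 1 < gamma) :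
  exists C : R, 0 < C /\
  forall (K n : nat) (alpha c : R),
    (0 < K)%N -> (0 < n)%N -> 0 < alpha < 1 -> 1 <= alpha ^+ 2 * n%:R ->
    1 <= c ->
  forall (d : measure_display) (T : measurableType d)
    (x1 x2 : 'I_n -> T -> 'I_K) (w : 'I_n -> 'I_K -> {mfun T >-> R})
    (z2 : 'I_n -> {mfun T >-> R}),
  let m := alpha ^+ 2 * n%:R in
  let tau := c / Num.sqrt m in
  (forall (p : 'I_K -> R) (P : probability T R),
     simplex p -> si_experiment P alpha gamma p x1 x2 w z2 ->
     (quadratic_risk P gamma p (fun i => z2 i) <=
      (C * ((m `^ Num.min (gamma - 1) 1)^-1
            + (3 <= gamma)%R%:R *
                (trunc_power_sum tau (gamma - 2) p ^+ 2 / m ^+ 2)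
            + (2 <= gamma)%R%:R *
                (trunc_power_sum tau (2 * gamma - 2) p / m)))%:E)%E) /\
  (forall P : ('I_K -> R) -> probability T R,
     (forall p, simplex p -> si_experiment (P p) alpha gamma p x1 x2 w z2) ->
     (ereal_sup [set quadratic_risk (P p) gamma p (fun i => z2 i) |
                  p in @simplex R K] <=
      (C * ((m `^ (gamma - 1))^-1 + m^-1))%:E)%E).
Proof.
have [C [C0 rate]] := quadratic_risk_le_rate hgamma.
exists C; split => // K n alpha c K0 n0 alpha01 m1 c1 d T x1 x2 w z2 m tau.
have m0 : 0 < m by exact: lt_le_trans m1.
split=> [p P psimplex H|P H].
  apply: le_trans (rate _ _ _ _ _ _ _ _ _ _ _ n0 alpha01 m1 psimplex H) _.
  rewrite lee_fin ler_wpM2l ?(ltW C0)// -addrA lerDl addr_ge0// mulr_ge0//.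
    by rewrite divr_ge0 ?sqr_ge0.
  by rewrite divr_ge0 ?(ltW m0)//; apply: sumr_ge0 => k _; exact: powR_ge0.
apply: ge_ereal_sup => _ [p psimplex <-].
apply: le_trans (rate _ _ _ _ _ _ _ _ _ _ _ n0 alpha01 m1 psimplex (H p psimplex)) _.
rewrite lee_fin ler_wpM2l ?(ltW C0)//.
have s0 : 0 <= (m `^ (gamma - 1))^-1 by rewrite invr_ge0 powR_ge0.
have m'0 : 0 <= m^-1 by rewrite invr_ge0 ltW.
(* The minimum is one of the two exponents, so the rate is one of the two nonnegative summands. *)
rewrite -/m; case: (leP (gamma - 1) 1) => _; first by rewrite lerDl.
by rewrite powRr1 ?lerDr// ltW.
Qed.
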